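(* Let $$\phi^{\rm e}(x,y)=(u^{\rm e}(x,y),u^{\rm e}(y,x)),\qquad u^{\rm e}(x,y)=\tfrac12\left((x-y)e^{x+y}+x+y\right),$$ and $$\phi^{\rm t}(x,y)=(u^{\rm t}(x,y),u^{\rm t}(y,x)),\qquad u^{\rm t}(x,y)=\frac{(x+y)x+(x+y)y\tan(x+y)}{x+y+(y-x)\tan(x+y)}.$$ These functions are symmetric projective flows. Both $u=u^{\rm e}$ and $u=u^{\rm t}$ satisfy the PDE $$u_x(x,y)(\varpi(x,y)-x)+u_y(x,y)(\varrho(x,y)-y)=-u(x,y),$$ where $\varpi(x,y)=\frac12(x^2-y^2)=\varrho(y,x)$ in the exponential case, and $\varpi(x,y)=x^2+y^2=\varrho(y,x)$ in the tangent case, respectively. The projective flow property is equivalent to the addition formulas for the corresponding functions (exponential and tangent).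
   Context: Write $\mathbf{x}=(x,y)$. The projective translation equation for a pair $\phi=(u,v)$ of functions of two complex variables is $$(1-z)\phi(\mathbf{x})=\phi\left(\phi(\mathbf{x}z)\frac{1-z}{z}\right).$$ A projective flow is a solution that also satisfies the boundary condition $\lim_{z\to0}\phi(\mathbf{x}z)/z=\mathbf{x}$. Symmetric means symmetric with respect to the linear involution $(x,y)\mapsto(y,x)$. The addition formulas in question are $f(x+y)=f(x)f(y)$ for the exponential function and $f(x+y)=\frac{f(x)+f(y)}{1-f(x)f(y)}$ for the tangent function; the idea behind the last sentence is to replace the known function (exponential or tangent) in the expression of the flow by an unknown function $f$ and to require that the projective translation equation hold.
   Formalization: Tangent case false as printed; proved for u^t(x,-y), and for u^t with pair (u(x,y),-u(-y,-x)), ϱ=-(x²+y²), symmetric under (x,y)->(-y,-x). Equivalence: f meets the boundary condition; tangent f continuous on a connected open symmetric domain, differentiable at 0. *)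

(* Defs.v *)
(* Stdlib reals with Coquelicot's complex numbers [C] and complex derivatives. *)
From Stdlib Require Import Reals.
From Coquelicot Require Import Coquelicot.

Local Open Scope C_scope.

Definition Cexp (z : C) : C :=
  ((exp (Re z) * cos (Im z))%R, (exp (Re z) * sin (Im z))%R).
Definition Ccos (z : C) : C := (Cexp (Ci * z) + Cexp (- (Ci * z))) / 2.
Definition Csin (z : C) : C := (Cexp (Ci * z) - Cexp (- (Ci * z))) / (2 * Ci).
(* Meaningful only where [Ccos z <> 0]. *)
Definition Ctan (z : C) : C := Csin z / Ccos z.

(* A map of two complex variables is a total function together with the set
   [dom] on which it is to be considered: division is total in the library. *)

Definition scale (z : C) (p : C * C) : C * C := (z * fst p, z * snd p).

Definition projective_translation_equation
    (dom : C * C -> Prop) (phi : C * C -> C * C) : Prop :=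
  forall (p : C * C) (z : C), z <> 0 ->
    dom p -> dom (scale z p) ->
    dom (scale ((1 - z) / z) (phi (scale z p))) ->
    scale (1 - z) (phi p) = phi (scale ((1 - z) / z) (phi (scale z p))).

(* The first clause makes the limit one of values taken inside [dom]. *)
Definition boundary_condition
    (dom : C * C -> Prop) (phi : C * C -> C * C) : Prop :=
  forall p : C * C,
    locally' (T := C_UniformSpace) (RtoC 0) (fun z => dom (scale z p)) /\
    filterlim (fun z : C => scale (/ z) (phi (scale z p)))
      (locally' (T := C_UniformSpace) (RtoC 0))
      (locally (T := prod_UniformSpace C_UniformSpace C_UniformSpace) p).

Definition projective_flow
    (dom : C * C -> Prop) (phi : C * C -> C * C) : Prop :=
  projective_translation_equation dom phi /\ boundary_condition dom phi.

Definition symmetric_under (sigma : C * C -> C * C)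
    (dom : C * C -> Prop) (phi : C * C -> C * C) : Prop :=
  forall p, dom p -> dom (sigma p) /\ phi (sigma p) = sigma (phi p).

Definition swap (p : C * C) : C * C := (snd p, fst p).
Definition antiswap (p : C * C) : C * C := (- snd p, - fst p).

Definition solves_pde (dom : C -> C -> Prop) (u varpi varrho : C -> C -> C) : Prop :=
  forall x y : C, dom x y ->
    exists ux uy : C,
      is_derive (K := C_AbsRing) (V := C_NormedModule) (fun t => u t y) x ux /\
      is_derive (K := C_AbsRing) (V := C_NormedModule) (fun t => u x t) y uy /\
      ux * (varpi x y - x) + uy * (varrho x y - y) = - u x y.

(** * Exponential case, with an arbitrary function [f] in the place of exp *)

Definition u_exp (f : C -> C) (x y : C) : C :=
  / 2 * ((x - y) * f (x + y) + x + y).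

Definition phi_exp (f : C -> C) (p : C * C) : C * C :=
  (u_exp f (fst p) (snd p), u_exp f (snd p) (fst p)).

Definition everywhere (p : C * C) : Prop := True.

Definition varpi_exp (x y : C) : C := / 2 * (x * x - y * y).
Definition varrho_exp (x y : C) : C := varpi_exp y x.

Definition exp_addition_formula (f : C -> C) : Prop :=
  forall a b : C, f (a + b) = f a * f b.

(** * Tangent case, with a function [f] on a set [D] in the place of tan *)

(* On the line [x + y = 0] the quotient reads 0/0; when [f 0 = 0] and
   [f' 0 = c] its continuous extension there is [x / (1 + c * (y - x))]. *)
Definition u_tan (f : C -> C) (c x y : C) : C :=
  if Ceq_dec (x + y) 0 then x / (1 + c * (y - x))
  else ((x + y) * x + (x + y) * y * f (x + y)) / (x + y + (y - x) * f (x + y)).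

Definition u_tan_dom (D : C -> Prop) (f : C -> C) (c x y : C) : Prop :=
  D (x + y) /\
  (if Ceq_dec (x + y) 0 then 1 + c * (y - x) <> 0
   else x + y + (y - x) * f (x + y) <> 0).

(* For [u := u_tan Ctan 1], the pair (u (x, y), u (y, x)) is not a projective
   flow: on the diagonal it is t |-> t (1 + tan (2t)), so that for z = -1 and
   2t -> PI/4 the two sides of the translation equation tend to PI/2 and 0.
   The integral curves of the vector field (x^2 + y^2, x^2 + y^2) keep [x - y]
   constant, so its flow involves tan (x - y): it is obtained from
   u (x, - y).  The function [u] itself is the first component of the flow
   (u (x, y), - u (- y, - x)) of (x^2 + y^2, - (x^2 + y^2)), which keeps [x + y]
   constant and is symmetric under (x, y) |-> (- y, - x).  The two flows are
   conjugate by (x, y) |-> (x, - y). *)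
Definition u_tan_sym (f : C -> C) (c x y : C) : C := u_tan f c x (- y).

Definition u_tan_sym_dom (D : C -> Prop) (f : C -> C) (c x y : C) : Prop :=
  u_tan_dom D f c x (- y).

Definition phi_tan_sym (f : C -> C) (c : C) (p : C * C) : C * C :=
  (u_tan_sym f c (fst p) (snd p), u_tan_sym f c (snd p) (fst p)).

Definition phi_tan_sym_dom (D : C -> Prop) (f : C -> C) (c : C) (p : C * C) : Prop :=
  u_tan_sym_dom D f c (fst p) (snd p) /\ u_tan_sym_dom D f c (snd p) (fst p).

Definition phi_tan_anti (f : C -> C) (c : C) (p : C * C) : C * C :=
  (u_tan f c (fst p) (snd p), - u_tan f c (- snd p) (- fst p)).

Definition phi_tan_anti_dom (D : C -> Prop) (f : C -> C) (c : C) (p : C * C) : Prop :=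
  u_tan_dom D f c (fst p) (snd p) /\ u_tan_dom D f c (- snd p) (- fst p).

Definition varpi_tan (x y : C) : C := x * x + y * y.
Definition varrho_tan (x y : C) : C := varpi_tan y x.

Definition Ctan_dom (z : C) : Prop := Ccos z <> 0.

Definition tan_addition_formula (D : C -> Prop) (f : C -> C) : Prop :=
  forall a b : C, D a -> D b -> D (a + b) -> 1 - f a * f b <> 0 ->
    f (a + b) = (f a + f b) / (1 - f a * f b).

(* Coquelicot's [is_connected] is about subsets of R only. *)
Definition connected (D : C -> Prop) : Prop :=
  forall U V : C -> Prop,
    open (T := C_UniformSpace) U -> open (T := C_UniformSpace) V ->
    (forall z, D z -> U z \/ V z) ->
    (forall z, D z -> U z -> V z -> False) ->
    (forall z, D z -> U z) \/ (forall z, D z -> V z).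

Definition tangent_like (D : C -> Prop) (f : C -> C) (c : C) : Prop :=
  open (T := C_UniformSpace) D /\ connected D /\ D 0 /\
  (forall t, D t -> D (- t)) /\
  (forall t, D t -> continuous (T := C_UniformSpace) (U := C_UniformSpace) f t) /\
  is_derive (K := C_AbsRing) (V := C_NormedModule) f (RtoC 0) c.

(* Main.v *)
(* In the coordinates s = x + y, d = x - y the exponential map is
   (s, d) |-> (s, d f(s)), and the tangent map (in its antisymmetric form) is
   (s, d) |-> (s, s tan (arctan (d / s) + arctan f(s))), provided f is odd.  In
   both cases the translation equation is the addition formula between the
   arguments z s and (1 - z) s, and points with d <> 0, resp. d = 0, recover it.

   The analysis lies in what the addition formula leaves open for a general f.
   From the formula: {f = i} and {f = -i} are open and closed in D, hence empty,
   and then {f(t) + f(-t) = 0} is open and closed too; if f(a) f(b) = 1 with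
   a + b in D, then f vanishes near 0, hence on D.  From the flow: oddness holds
   because t |-> phi(t x) / t is an integral curve of the vector field
   (c (x^2 + y^2), - c (x^2 + y^2)), whose components have sum 0, so that
   f(t) + f(-t) has derivative 0 on D. *)
Require Import Defs.
From Stdlib Require Import Reals Lra Classical.
From Coquelicot Require Import Coquelicot.

Local Open Scope C_scope.

(** Both equivalences carry the boundary condition as a hypothesis because the addition formulas
    have degenerate solutions: the zero function in the exponential case; the constant i, or
    vacuously the constant 1, in the tangent case. The condition excludes them by fixing the value
    at 0.

    The obstacle in the tangent case is partiality. The translation equation is asserted only where
    all three points avoid zero denominators, and the addition formula only where 1 - f a f b <> 0.
    The flow is therefore deduced from the multiplied-out form f (a + b) (1 - f a f b) = f a + f b,
    where the nonvanishing of 1 - f a f b is read off from the domain of the flow; most of the work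
    from the formula to the flow is in reaching that form. In the other direction oddness has to
    come before the addition formula: the second component contains f (- s), and only an odd f makes
    s = x + y invariant. *)

Local Notation loc a := (locally (T := C_UniformSpace) (a : C)).
Local Notation loc' a := (locally' (T := C_UniformSpace) (a : C)).
Local Notation cderive f x l :=
  (is_derive (K := C_AbsRing) (V := C_NormedModule) (f : C -> C) (x : C) (l : C)).

(** * Limits of complex functions *)

#[local] Instance locC_filter (a : C) : @Filter C (loc a) :=
  @filter_filter _ _ (locally_filter (T := C_UniformSpace) a).
#[local] Instance locC'_filter (a : C) : @Filter C (loc' a) :=
  locally'_filter (T := C_UniformSpace) a.

(** The balls of [C_UniformSpace] are squares, those of the absolute ring are discs. [locally_C]
    compares the two, and its right side unfolds to this one. *)
Lemma locally_Cmod (x : C) (P : C -> Prop) :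
  loc x P <-> exists d : posreal, forall y, (Cmod (y - x) < d)%R -> P y.
Proof. exact (locally_C x P). Qed.

Lemma Csub_neq (a b : C) : a <> b -> a - b <> 0.
Proof. intros H E. apply H. replace a with (a - b + b) by ring. rewrite E. ring. Qed.

Lemma tends_Cmod {T : Type} (F : (T -> Prop) -> Prop) {FF : Filter F} (f : T -> C) (l : C) :
  filterlim f F (loc l) <->
  forall eps : posreal, F (fun t => (Cmod (f t - l) < eps)%R).
Proof.
split.
- intros H eps. apply (H (fun y => (Cmod (y - l) < eps)%R)).
  apply locally_Cmod. now exists eps.
- intros H P HP. apply locally_Cmod in HP. destruct HP as [d Hd].
  apply (filter_imp (F := F) _ _ (fun t Ht => Hd _ Ht) (H d)).
Qed.

Lemma tends_eq {T : Type} (F : (T -> Prop) -> Prop) (f : T -> C) (a b : C) :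
  filterlim f F (loc a) -> a = b -> filterlim f F (loc b).
Proof. now intros H <-. Qed.

Section Limits.
Context {T : Type} (F : (T -> Prop) -> Prop) {FF : Filter F}.
Implicit Types f g : T -> C.

Lemma tends_const (a : C) : filterlim (fun _ : T => a) F (loc a).
Proof. apply filterlim_const. Qed.

Lemma tends_plus f g (a b : C) :
  filterlim f F (loc a) -> filterlim g F (loc b) ->
  filterlim (fun t => f t + g t) F (loc (a + b)).
Proof.
intros Hf Hg.
apply (filterlim_comp_2 (G := loc a) (H := loc b) f g Cplus Hf Hg).
apply (filterlim_plus (K := C_AbsRing) (V := C_NormedModule)).
Qed.

Lemma tends_mult f g (a b : C) :
  filterlim f F (loc a) -> filterlim g F (loc b) ->
  filterlim (fun t => f t * g t) F (loc (a * b)).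
Proof.
intros Hf Hg.
(* [filterlim_scal] takes its scalar in the uniform structure of the absolute ring. *)
assert (Hf' : filterlim f F (locally (T := AbsRing_UniformSpace C_AbsRing) a)).
{ intros P HP. apply Hf. now apply locally_C. }
apply (filterlim_comp_2 f g Cmult Hf' Hg).
apply (filterlim_scal (K := C_AbsRing) (V := C_NormedModule) a b).
Qed.

Lemma tends_opp f (a : C) :
  filterlim f F (loc a) -> filterlim (fun t => - f t) F (loc (- a)).
Proof.
intros Hf.
apply (filterlim_comp _ _ _ f Copp _ (loc a)); [exact Hf|].
apply (filterlim_opp (K := C_AbsRing) (V := C_NormedModule)).
Qed.
Lemma tends_minus f g (a b : C) :
  filterlim f F (loc a) -> filterlim g F (loc b) ->
  filterlim (fun t => f t - g t) F (loc (a - b)).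
Proof. intros Hf Hg. apply tends_plus; [exact Hf | now apply tends_opp]. Qed.

Lemma tends_neq f (a b : C) :
  filterlim f F (loc a) -> a <> b -> F (fun t => f t <> b).
Proof.
intros Hf Hab.
assert (Hp : (0 < Cmod (b - a))%R).
{ apply Cmod_gt_0, Csub_neq. congruence. }
apply tends_Cmod with (eps := mkposreal _ Hp) in Hf; [|exact FF].
revert Hf. apply filter_imp. intros t Ht E. rewrite E in Ht. simpl in Ht. lra.
Qed.
End Limits.

Lemma tends_Cinv (a : C) : a <> 0 -> filterlim Cinv (loc a) (loc (/ a)).
Proof.
intros Ha. apply tends_Cmod; [apply locC_filter|]. intros eps.
pose proof (proj1 (Cmod_gt_0 a) Ha) as Hm.
(* The first bound keeps |y| above |a| / 2; the second then gives |y - a| < eps |a|^2 / 2 <= eps |y|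
   |a|. *)
assert (Hd : (0 < Rmin (Cmod a / 2) (eps * (Cmod a * Cmod a) / 2))%R).
{ apply Rmin_pos; [lra|]. pose proof (cond_pos eps).
  apply Rdiv_lt_0_compat; [|lra]. repeat apply Rmult_lt_0_compat; lra. }
apply locally_Cmod. exists (mkposreal _ Hd). simpl. intros y Hy.
assert (H1 := Rlt_le_trans _ _ _ Hy (Rmin_l _ _)).
assert (H2 := Rlt_le_trans _ _ _ Hy (Rmin_r _ _)).
assert (H3 : (Cmod a / 2 < Cmod y)%R).
{ pose proof (Cmod_triangle (a - y) y) as Ht.
  replace (a - y + y) with a in Ht by ring.
  rewrite <- (Cmod_opp (a - y)) in Ht.
  replace (- (a - y)) with (y - a) in Ht by ring. lra. }
assert (Hy0 : y <> 0) by (apply Cmod_gt_0; lra).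
replace (/ y - / a) with (- ((y - a) / (y * a))) by (field; split; assumption).
rewrite Cmod_opp, Cmod_div by now apply Cmult_neq_0.
rewrite Cmod_mult.
apply Rmult_lt_reg_r with (Cmod y * Cmod a)%R; [apply Rmult_lt_0_compat; lra|].
unfold Rdiv at 1. rewrite Rmult_assoc, Rinv_l, Rmult_1_r
  by (apply Rgt_not_eq, Rmult_lt_0_compat; lra).
eapply Rlt_le_trans; [exact H2|].
pose proof (cond_pos eps).
replace (eps * (Cmod a * Cmod a) / 2)%R with (eps * (Cmod a / 2 * Cmod a))%R by field.
apply Rmult_le_compat_l; [lra|]. apply Rmult_le_compat_r; lra.
Qed.

Lemma tends_inv {T : Type} (F : (T -> Prop) -> Prop) (f : T -> C) (a : C) :
  a <> 0 -> filterlim f F (loc a) -> filterlim (fun t => / f t) F (loc (/ a)).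
Proof.
intros Ha Hf. apply (filterlim_comp _ _ _ f Cinv _ (loc a)); [exact Hf|].
now apply tends_Cinv.
Qed.

Lemma tends_div {T : Type} (F : (T -> Prop) -> Prop) {FF : Filter F} (f g : T -> C) (a b : C) :
  b <> 0 -> filterlim f F (loc a) -> filterlim g F (loc b) ->
  filterlim (fun t => f t / g t) F (loc (a / b)).
Proof. intros Hb Hf Hg. apply tends_mult; auto. now apply tends_inv. Qed.

Lemma tends_id' (a : C) : filterlim (fun z : C => z) (loc' a) (loc a).
Proof. intros P HP. apply filter_le_within. exact HP. Qed.

Lemma loc'_neq (a : C) : loc' a (fun z => z <> a).
Proof.
exists (mkposreal 1 Rlt_0_1). intros y _ Hy; exact Hy. Qed.

#[local] Instance locC'_proper (a : C) : @ProperFilter C (loc' a).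
Proof.
split; [|typeclasses eauto]. intros P H.
apply locally_Cmod in H. destruct H as [d Hd]. pose proof (cond_pos d) as Hp.
exists (a + RtoC (d / 2)). apply Hd.
- replace (a + RtoC (d / 2) - a) with (RtoC (d / 2)) by ring.
  rewrite Cmod_R, Rabs_pos_eq; lra.
- intros E. assert (E' : RtoC (d / 2) = 0).
  { replace (RtoC (d / 2)) with (a + RtoC (d / 2) - a) by ring. rewrite E. ring. }
  injection E'. lra.
Qed.

Lemma loc_loc' (a : C) P : loc a P -> loc' a P.
Proof. intros H. apply filter_le_within. exact H. Qed.

(** The limit must already have the shape of the function. [tends_eq] supplies that shape beforehand
    and leaves an identity for [ring] or [field]. *)
Ltac tends :=
  repeat match goal with
  | |- Filter _ => typeclasses eauto
  | |- filterlim (fun _ => ?c) _ (locally ?c) => apply tends_const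
  | |- filterlim (fun _ => _ + _) _ (locally (_ + _)) => apply tends_plus
  | |- filterlim (fun _ => _ - _) _ (locally (_ - _)) => apply tends_minus
  | |- filterlim (fun _ => _ * _) _ (locally (_ * _)) => apply tends_mult
  | |- filterlim (fun _ => _ / _) _ (locally (_ / _)) => apply tends_div
  | |- filterlim (fun _ => - _) _ (locally (- _)) => apply tends_opp
  | |- filterlim (fun _ => / _) _ (locally (/ _)) => apply tends_inv
  end.

Lemma tends_mult_l' (s : C) : s <> 0 -> filterlim (fun z => z * s) (loc' 0) (loc' 0).
Proof.
intros Hs P HP. unfold filtermap.
assert (H : loc' 0 (fun z => z * s <> 0)).
{ generalize (loc'_neq 0). apply filter_imp. intros z Hz. now apply Cmult_neq_0. }
assert (H2 : filterlim (fun z => z * s) (loc' 0) (loc 0)).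
{ replace (RtoC 0) with (0 * s) at 2 by ring.
  tends; apply tends_id'. }
unfold locally', within in HP. generalize (filter_and _ _ H (H2 _ HP)).
apply filter_imp. intros z [A B]. now apply B.
Qed.

Lemma tends_pair {T : Type} (F : (T -> Prop) -> Prop) {FF : Filter F} (f : T -> C * C) (p : C * C) :
  filterlim f F (locally (T := prod_UniformSpace C_UniformSpace C_UniformSpace) p) <->
  filterlim (fun t => fst (f t)) F (loc (fst p)) /\
  filterlim (fun t => snd (f t)) F (loc (snd p)).
Proof.
split.
- intros H; split; intros P [d Hd];
    [apply (H (fun q => P (fst q))) | apply (H (fun q => P (snd q)))];
    exists d; intros q [H1 H2]; now apply Hd.
- intros [H1 H2] P [d Hd].
  assert (A1 := H1 _ (locally_ball _ d)). assert (A2 := H2 _ (locally_ball _ d)).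
  unfold filtermap in *. generalize (filter_and _ _ A1 A2).
  apply filter_imp. intros t [B1 B2]. apply Hd. exact (conj B1 B2).
Qed.

Lemma cderive_tends (f : C -> C) (x l : C) :
  cderive f x l <-> filterlim (fun y => (f y - f x) / (y - x)) (loc' x) (loc l).
Proof.
rewrite tends_Cmod by apply locally'_filter.
split.
- intros [_ H] eps.
  (* Half of [eps] turns the non-strict bound of the definition into a strict one. *)
  specialize (H x (fun P HP => HP) (pos_div_2 eps)).
  assert (H' := proj2 (locally_C x _) H). apply locally_Cmod in H'.
  destruct H' as [d Hd].
  apply locally_Cmod. exists d. intros y Hy Hyx.
  assert (Hne := Csub_neq y x Hyx).
  pose proof (proj1 (Cmod_gt_0 _) Hne) as Hp.
  specialize (Hd y Hy).
  change (Cmod ((f y - f x) - (y - x) * l) <= eps / 2 * Cmod (y - x))%R in Hd.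
  replace ((f y - f x) / (y - x) - l) with (((f y - f x) - (y - x) * l) / (y - x))
    by (field; exact Hne).
  rewrite Cmod_div by exact Hne.
  apply Rmult_lt_reg_r with (Cmod (y - x)); [exact Hp|].
  unfold Rdiv at 1. rewrite Rmult_assoc, Rinv_l, Rmult_1_r by lra.
  pose proof (cond_pos eps). nra.
- intros H. split; [apply (is_linear_scal_l (K := C_AbsRing) (V := C_NormedModule))|].
  intros y Hy eps.
  (* [filterdiff] quantifies over every limit of the filter; here [x] is the only one. *)
  assert (y = x). { symmetry. apply (is_filter_lim_locally_unique (K := C_AbsRing) (V := AbsRing_NormedModule C_AbsRing)). exact Hy. }
  subst y. apply (proj1 (locally_C x _)).
  specialize (H eps). apply locally_Cmod in H. destruct H as [d Hd].
  apply locally_Cmod. exists d. intros y Hyd.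
  change (Cmod ((f y - f x) - (y - x) * l) <= eps * Cmod (y - x))%R.
  destruct (Ceq_dec y x) as [->|Hyx].
  + replace (f x - f x - (x - x) * l) with (RtoC 0) by ring.
    replace (x - x) with (RtoC 0) by ring. rewrite Cmod_0. lra.
  + assert (Hne : y - x <> 0).
    { intros E. apply Hyx. replace y with (y - x + x) by ring. rewrite E. ring. }
    specialize (Hd y Hyd Hyx).
    replace (f y - f x - (y - x) * l) with (((f y - f x) / (y - x) - l) * (y - x))
      by (field; exact Hne).
    rewrite Cmod_mult. apply Rmult_le_compat_r; [apply Cmod_ge_0 | lra].
Qed.

(** * Complex derivatives *)

Lemma cderive_ext_loc (f g : C -> C) (x l : C) :
  loc x (fun t => f t = g t) -> cderive f x l -> cderive g x l.
Proof. intros H. apply is_derive_ext_loc. exact (proj1 (locally_C _ _) H). Qed.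

Lemma cderive_eq (f : C -> C) (x l l' : C) : cderive f x l -> l = l' -> cderive f x l'.
Proof. now intros H <-. Qed.

Lemma cderive_const (a x : C) : cderive (fun _ => a) x 0.
Proof. exact (is_derive_const (K := C_AbsRing) (V := C_NormedModule) a x). Qed.

(* [C_NormedModule] and [AbsRing_NormedModule C_AbsRing] have the same norm but
   their uniform structures are not convertible. *)
Lemma cderive_AbsRing (f : C -> C) (x l : C) :
  cderive f x l <->
  is_derive (K := C_AbsRing) (V := AbsRing_NormedModule C_AbsRing) f x l.
Proof.
split; intros [_ H]; (split; [apply is_linear_scal_l | exact H]).
Qed.

Lemma cderive_id (x : C) : cderive (fun t => t) x 1.
Proof. apply cderive_AbsRing. exact (is_derive_id (K := C_AbsRing) x). Qed.

Lemma cderive_plus (f g : C -> C) (x a b : C) :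
  cderive f x a -> cderive g x b -> cderive (fun t => f t + g t) x (a + b).
Proof. exact (is_derive_plus (K := C_AbsRing) (V := C_NormedModule) f g x a b). Qed.

Lemma cderive_opp (f : C -> C) (x a : C) :
  cderive f x a -> cderive (fun t => - f t) x (- a).
Proof. exact (is_derive_opp (K := C_AbsRing) (V := C_NormedModule) f x a). Qed.

Lemma cderive_minus (f g : C -> C) (x a b : C) :
  cderive f x a -> cderive g x b -> cderive (fun t => f t - g t) x (a - b).
Proof. exact (is_derive_minus (K := C_AbsRing) (V := C_NormedModule) f g x a b). Qed.

Lemma cderive_mult (f g : C -> C) (x a b : C) :
  cderive f x a -> cderive g x b ->
  cderive (fun t => f t * g t) x (a * g x + f x * b).
Proof.
intros Hf Hg. apply cderive_AbsRing.
apply -> cderive_AbsRing in Hf. apply -> cderive_AbsRing in Hg.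
exact (is_derive_mult (K := C_AbsRing) f g x a b Hf Hg Cmult_comm).
Qed.

Lemma cderive_comp (f g : C -> C) (x a b : C) :
  cderive f (g x) a -> cderive g x b -> cderive (fun t => f (g t)) x (b * a).
Proof.
intros Hf Hg. apply -> cderive_AbsRing in Hg.
exact (is_derive_comp (K := C_AbsRing) (V := C_NormedModule) f g x a b Hf Hg).
Qed.

Lemma cderive_continuous (f : C -> C) (x l : C) :
  cderive f x l -> filterlim f (loc x) (loc (f x)).
Proof.
intros H.
assert (Hc := ex_derive_continuous (K := C_AbsRing) (V := C_NormedModule) f x (ex_intro _ l H)).
intros P HP. apply locally_C. exact (Hc P HP).
Qed.

Lemma cderive_Cinv (x : C) : x <> 0 -> cderive Cinv x (- / (x * x)).
Proof.
intros Hx. apply cderive_tends.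
apply filterlim_ext_loc with (f := fun y => - / (y * x)).
- assert (H := tends_neq _ _ _ _ (tends_id' x) Hx).
  generalize (filter_and _ _ (loc'_neq x) H). apply filter_imp.
  intros y [H1 H2]. assert (H3 := Csub_neq _ _ H1).
  field. repeat split; assumption.
- tends; [now apply Cmult_neq_0 | apply tends_id'].
Qed.

Lemma cderive_div (f g : C -> C) (x a b : C) :
  cderive f x a -> cderive g x b -> g x <> 0 ->
  cderive (fun t => f t / g t) x ((a * g x - f x * b) / (g x * g x)).
Proof.
intros Hf Hb Hg.
replace ((a * g x - f x * b) / (g x * g x)) with
  (a * / g x + f x * (b * - / (g x * g x))) by (field; exact Hg).
refine (cderive_mult f (fun t => / g t) x a _ Hf _).
refine (cderive_comp Cinv g x _ _ _ Hb). now apply cderive_Cinv.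
Qed.

(** * Mean value inequality and connectedness *)

Lemma Re_Im_le (z : C) : (Cmod z <= Rabs (Re z) + Rabs (Im z))%R.
Proof.
destruct z as [a b]. replace (a, b) with (RtoC a + Ci * RtoC b)
  by (apply injective_projections; simpl; ring).
eapply Rle_trans; [apply Cmod_triangle|].
rewrite Cmod_mult, Cmod_Ci, !Cmod_R. simpl.
replace (a + (0 * b - 1 * 0))%R with a by ring.
replace (0 + (0 * 0 + 1 * b))%R with b by ring. lra.
Qed.

Lemma im_le_Cmod (z : C) : (Rabs (Im z) <= Cmod z)%R.
Proof. eapply Rle_trans; [apply Rmax_r | apply Rmax_Cmod]. Qed.

(** [p] stands for [Re] and [Im]: a real-linear functional of norm at most 1. It brings a complex
    derivative down to one real variable, where the mean value theorem is valid. *)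
Lemma derive_along_segment (p : C -> R) (f : C -> C) (z w l : C) (r : R) :
  (forall a b : C, p (a - b) = (p a - p b)%R) ->
  (forall (a : C) (b : R), p (b * a) = (b * p a)%R) ->
  (forall a : C, (Rabs (p a) <= Cmod a)%R) ->
  cderive f (z + r * w) l ->
  is_derive (fun r : R => p (f (z + r * w))) r (p (l * w)).
Proof.
intros pB pZ pM H.
assert (Ht : filterlim (fun y : C => (f y - f (z + r * w)) / (y - (z + r * w)))
   (loc' (z + r * w)) (loc l)) by now apply cderive_tends.
destruct (Ceq_dec w 0) as [->|Hw].
- replace (p (l * 0)) with 0%R.
  + apply is_derive_ext with (f := fun _ : R => p (f z)).
    * intros t. do 2 f_equal. ring.
    * apply (is_derive_const (K := R_AbsRing) (V := R_NormedModule)).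
  + replace (l * 0) with (RtoC 0 * 0) by ring. rewrite pZ; ring.
- apply is_derive_Reals. intros eps Heps.
  pose proof (proj1 (Cmod_gt_0 w) Hw) as Hm.
  assert (He : (0 < eps / Cmod w)%R) by now apply Rdiv_lt_0_compat.
  apply tends_Cmod with (eps := mkposreal _ He) in Ht; [|typeclasses eauto].
  apply locally_Cmod in Ht. destruct Ht as [d Hd].
  assert (Hdm : (0 < d / Cmod w)%R) by (apply Rdiv_lt_0_compat; [apply cond_pos | lra]).
  exists (mkposreal _ Hdm). simpl. intros h Hh Hhd.
  assert (Hhc : RtoC h <> 0) by (intros E; apply Hh; now injection E).
  specialize (Hd (z + (r + h)%R * w)).
  replace (z + (r + h)%R * w - (z + r * w)) with (h * w) in Hd
    by (rewrite RtoC_plus; ring).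
  rewrite Cmod_mult, Cmod_R in Hd.
  assert (Hlt : (Rabs h * Cmod w < d)%R).
  { apply Rmult_lt_compat_r with (r := Cmod w) in Hhd; [|lra].
    unfold Rdiv in Hhd. rewrite Rmult_assoc, Rinv_l in Hhd; lra. }
  specialize (Hd Hlt). simpl in Hd.
  set (F1 := f (z + (r + h)%R * w)) in *. set (F0 := f (z + r * w)) in *.
  assert (Hne : z + (r + h)%R * w <> z + r * w).
  { intros E. apply (Cmult_neq_0 _ _ Hhc Hw).
    replace (h * w) with (z + (r + h)%R * w - (z + r * w)) by (rewrite RtoC_plus; ring).
    rewrite E; ring. }
  specialize (Hd Hne).
  replace ((p F1 - p F0) / h - p (l * w)%C)%R with (p (((F1 - F0) / (h * w) - l) * w)).
  + eapply Rle_lt_trans; [apply pM|]. rewrite Cmod_mult.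
    apply Rmult_lt_compat_r with (r := Cmod w) in Hd; [|lra].
    unfold Rdiv in Hd at 1. rewrite (Rmult_assoc eps), Rinv_l in Hd; lra.
  + replace (((F1 - F0) / (h * w) - l) * w) with ((/ h)%R * (F1 - F0) - l * w).
    * rewrite pB, pZ, pB. field. exact Hh.
    * rewrite RtoC_inv by exact Hh. field. split; assumption.
Qed.

(** The real inequality is applied to [Re] and [Im] separately, and adding the two bounds costs the
    factor 2. The range |r| <= 1 is the one required by [bounded_variation] between 0 and 1. *)
Lemma mean_value (f df : C -> C) (z w : C) (M : R) :
  (forall r : R, (Rabs r <= 1)%R ->
     cderive f (z + r * w) (df (z + r * w)) /\ (Cmod (df (z + r * w)%C) <= M)%R) ->
  (Cmod (f (z + w)%C - f z) <= 2 * (M * Cmod w))%R.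
Proof.
intros H.
assert (K : forall p : C -> R,
  (forall a b : C, p (a - b) = (p a - p b)%R) ->
  (forall (a : C) (b : R), p (b * a) = (b * p a)%R) ->
  (forall a : C, (Rabs (p a) <= Cmod a)%R) ->
  (Rabs (p (f (z + w) - f z)%C) <= M * Cmod w)%R).
{ intros p pB pZ pM.
  assert (Hb := bounded_variation (fun r : R => p (f (z + r * w)))
    (fun r => p (df (z + r * w) * w)) (M * Cmod w) 0 1).
  rewrite Rminus_0_r, Rabs_R1, Rmult_1_r, Cmult_1_l, Cmult_0_l, Cplus_0_r, <- pB in Hb.
  apply Hb. intros t Ht. rewrite Rminus_0_r in Ht. destruct (H t Ht) as [H1 H2].
  split; [now apply derive_along_segment|].
  eapply Rle_trans; [apply pM|]. rewrite Cmod_mult.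
  apply Rmult_le_compat_r; [apply Cmod_ge_0 | exact H2]. }
eapply Rle_trans; [apply Re_Im_le|].
assert (HR : (Rabs (Re (f (z + w) - f z)%C) <= M * Cmod w)%R).
{ apply K; [reflexivity | intros [a1 a2] b; simpl; ring | apply re_le_Cmod]. }
assert (HI : (Rabs (Im (f (z + w) - f z)%C) <= M * Cmod w)%R).
{ apply K; [reflexivity | intros [a1 a2] b; simpl; ring | apply im_le_Cmod]. }
lra.
Qed.

(** Every passage from a neighbourhood to all of [D] goes through this lemma: [f] is merely
    continuous there, so no identity theorem applies. *)
Lemma connected_subset (D P : C -> Prop) (z0 : C) :
  connected D -> D z0 -> P z0 ->
  (forall z, D z -> P z -> loc z (fun t => D t /\ P t)) ->
  (forall z, D z -> ~ P z -> loc z (fun t => D t /\ ~ P t)) ->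
  forall z, D z -> P z.
Proof.
intros HD H0 P0 H1 H2.
destruct (HD (fun z => D z /\ P z) (fun z => D z /\ ~ P z)) as [H|H].
- intros z [A B]. now apply H1.
- intros z [A B]. now apply H2.
- intros z Hz. destruct (classic (P z)); [left | right]; split; assumption.
- intros z _ [_ A] [_ B]. now apply B.
- intros z Hz. now apply H.
- destruct (proj2 (H z0 H0) P0).
Qed.

Lemma cderive_0_connected (D : C -> Prop) (g : C -> C) (z0 : C) :
  open (T := C_UniformSpace) D -> connected D -> D z0 ->
  (forall t, D t -> cderive g t 0) -> forall t, D t -> g t = g z0.
Proof.
intros Ho Hc H0 Hg. apply (connected_subset D _ z0); auto.
- intros z Hz E. destruct (proj1 (locally_Cmod _ _) (Ho z Hz)) as [d Hd].
  apply locally_Cmod. exists d. intros y Hy. split; [now apply Hd|].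
  rewrite <- E. replace y with (z + (y - z)) by ring.
  (* With the bound M = 0 the inequality becomes an equality of values on a disc inside [D]. *)
  assert (Hm := mean_value g (fun _ => 0) z (y - z) 0).
  rewrite Rmult_0_l, Rmult_0_r in Hm.
  assert (E0 : g (z + (y - z)) - g z = 0).
  { apply Cmod_eq_0, Rle_antisym; [|apply Cmod_ge_0].
    apply Hm. intros r Hr. split; [|rewrite Cmod_0; lra].
    apply Hg, Hd. replace (z + r * (y - z) - z) with (r * (y - z)) by ring.
    rewrite Cmod_mult, Cmod_R. pose proof (Cmod_ge_0 (y - z)). nra. }
  replace (g (z + (y - z))) with (g (z + (y - z)) - g z + g z) by ring.
  rewrite E0. ring.
- intros z Hz E. apply filter_and; [now apply Ho|].
  apply (tends_neq _ _ (g z)); [|exact E].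
  apply (cderive_continuous g z 0 (Hg z Hz)).
Qed.

(** * Complex exponential and tangent *)

Lemma Cexp_plus (a b : C) : Cexp (a + b) = Cexp a * Cexp b.
Proof.
destruct a as [a1 a2], b as [b1 b2]. unfold Cexp; simpl.
rewrite exp_plus, cos_plus, sin_plus.
apply injective_projections; simpl; ring.
Qed.

Lemma Cexp_0 : Cexp 0 = 1.
Proof.
unfold Cexp; simpl. rewrite exp_0, cos_0, sin_0.
apply injective_projections; simpl; ring.
Qed.

Lemma Cexp_neq_0 (z : C) : Cexp z <> 0.
Proof.
intros E. apply C1_nz. rewrite <- Cexp_0.
replace (RtoC 0) with (z + - z) by ring. rewrite Cexp_plus, E. ring.
Qed.

Lemma Cexp_opp (z : C) : Cexp (- z) = / Cexp z.
Proof.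
assert (H := Cexp_neq_0 z).
replace (Cexp (- z)) with (Cexp z * Cexp (- z) / Cexp z) by (field; exact H).
rewrite <- Cexp_plus. replace (z + - z) with (RtoC 0) by ring.
rewrite Cexp_0. field; exact H.
Qed.

Lemma first_order (f : R -> R) (l eps : R) : derivable_pt_lim f 0 l -> (0 < eps)%R ->
  exists d : posreal, forall h, (Rabs h < d -> Rabs (f h - f 0 - l * h) <= eps * Rabs h)%R.
Proof.
intros H He. destruct (H eps He) as [d Hd]. exists d. intros h Hh.
destruct (Req_dec h 0) as [->|Hn].
- replace (f 0 - f 0 - l * 0)%R with 0%R by ring. rewrite Rabs_R0. lra.
- specialize (Hd h Hn Hh). rewrite Rplus_0_l in Hd.
  replace (f h - f 0 - l * h)%R with (((f h - f 0) / h - l) * h)%R by (field; exact Hn).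
  rewrite Rabs_mult. apply Rmult_le_compat_r; [apply Rabs_pos | lra].
Qed.

Lemma cderive_Cexp_0 : cderive Cexp 0 1.
Proof.
apply cderive_tends. apply tends_Cmod; [typeclasses eauto|]. intros eps.
(* The real and imaginary parts of the remainder cost at most 3 e |z| and 5 e |z|, together less
   than 10 e |z|. The cap e <= 1 keeps the first order remainders below |z|. *)
set (e := Rmin (eps / 10) 1).
assert (He : (0 < e)%R) by (apply Rmin_pos; [pose proof (cond_pos eps); lra | lra]).
assert (He1 : (e <= 1)%R) by apply Rmin_r.
assert (He2 : (e <= eps / 10)%R) by apply Rmin_l.
destruct (first_order exp 1 e) as [d1 H1]; [|exact He|].
{ generalize (derivable_pt_lim_exp 0). now rewrite exp_0. }
destruct (first_order sin 1 e) as [d2 H2]; [|exact He|].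
{ generalize (derivable_pt_lim_sin 0). now rewrite cos_0. }
destruct (first_order cos 0 e) as [d3 H3]; [|exact He|].
{ generalize (derivable_pt_lim_cos 0). now rewrite sin_0, Ropp_0. }
(* The bound |z| < e / 2 absorbs the quadratic term of the imaginary part: (2 |z|)^2 <= 2 e |z|. *)
assert (Hd : (0 < Rmin (Rmin d1 d2) (Rmin d3 (e / 2)))%R).
{ repeat apply Rmin_pos; try apply cond_pos; lra. }
apply locally_Cmod. exists (mkposreal _ Hd). simpl. intros z Hz Hz0.
replace (z - 0) with z in * by ring.
assert (Hm := proj1 (Cmod_gt_0 z) Hz0).
rewrite Cexp_0.
replace ((Cexp z - 1) / z - 1) with ((Cexp z - 1 - z) / z) by (field; exact Hz0).
rewrite Cmod_div by exact Hz0.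
apply Rmult_lt_reg_r with (Cmod z); [exact Hm|].
unfold Rdiv. rewrite Rmult_assoc, Rinv_l, Rmult_1_r by lra.
destruct z as [a b].
assert (Ha := re_le_Cmod (a, b)). assert (Hb := im_le_Cmod (a, b)). simpl in Ha, Hb.
set (m := Cmod (a, b)) in *.
destruct (Rmin_Rgt_l _ _ _ Hz) as [M12 M34].
destruct (Rmin_Rgt_l _ _ _ M12) as [M1 M2]. destruct (Rmin_Rgt_l _ _ _ M34) as [M3 M4].
specialize (H1 a ltac:(lra)). specialize (H2 b ltac:(lra)). specialize (H3 b ltac:(lra)).
rewrite exp_0 in H1. rewrite sin_0 in H2. rewrite cos_0 in H3.
set (p := (exp a - 1 - 1 * a)%R) in *.
set (q := (sin b - 0 - 1 * b)%R) in *.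
set (r := (cos b - 1 - 0 * b)%R) in *.
eapply Rle_lt_trans; [apply Re_Im_le|].
replace (Re (Cexp (a, b) - 1 - (a, b))) with (p * cos b + (1 + a) * r)%R
  by (unfold p, r; simpl; ring).
replace (Im (Cexp (a, b) - 1 - (a, b))) with ((p + a) * (q + b) + q)%R
  by (unfold p, q; simpl; ring).
assert (Hc : (Rabs (cos b) <= 1)%R) by (apply Rabs_le, COS_bound).
assert (Pp : (Rabs p <= e * m)%R) by nra.
assert (Pq : (Rabs q <= e * m)%R) by nra.
assert (Pr : (Rabs r <= e * m)%R) by nra.
assert (Hr : (Rabs (p * cos b + (1 + a) * r) <= 3 * (e * m))%R).
{ eapply Rle_trans; [apply Rabs_triang|]. rewrite !Rabs_mult.
  assert (Rabs (1 + a) <= 2)%R.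
  { eapply Rle_trans; [apply Rabs_triang|]. rewrite Rabs_R1. lra. }
  pose proof (Rabs_pos p). pose proof (Rabs_pos r). nra. }
assert (Hi : (Rabs ((p + a) * (q + b) + q) <= 5 * (e * m))%R).
{ eapply Rle_trans; [apply Rabs_triang|]. rewrite Rabs_mult.
  assert (Rabs (p + a) <= 2 * m)%R by (eapply Rle_trans; [apply Rabs_triang|]; nra).
  assert (Rabs (q + b) <= 2 * m)%R by (eapply Rle_trans; [apply Rabs_triang|]; nra).
  pose proof (Rabs_pos (p + a)). pose proof (Rabs_pos (q + b)). nra. }
assert (e * m <= eps / 10 * m)%R by (apply Rmult_le_compat_r; lra).
pose proof (Rmult_lt_0_compat _ _ (cond_pos eps) Hm). lra.
Qed.

Lemma cderive_Cexp (z : C) : cderive Cexp z (Cexp z).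
Proof.
apply cderive_ext_loc with (f := fun t => Cexp z * Cexp (t - z)).
- apply filter_forall. intros t. rewrite <- Cexp_plus. f_equal. ring.
- assert (H : cderive (fun t => Cexp (t - z)) z ((1 - 0) * 1)).
  { apply (cderive_comp Cexp (fun t => t - z)).
    - replace (z - z) with (RtoC 0) by ring. exact cderive_Cexp_0.
    - apply (cderive_minus (fun t => t) (fun _ => z)); [apply cderive_id | apply cderive_const]. }
  refine (cderive_eq _ _ _ _ (cderive_mult _ _ _ _ _ (cderive_const (Cexp z) z) H) _). ring.
Qed.

Lemma Ci2 : Ci * Ci = - (1).
Proof. apply injective_projections; simpl; ring. Qed.

Lemma Ci_neq_0 : Ci <> 0.
Proof. intros E. injection E. lra. Qed.

Lemma C2_neq_0 : RtoC 2 <> 0.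
Proof. intros E. injection E. lra. Qed.

Lemma Ccos_plus (a b : C) : Ccos (a + b) = Ccos a * Ccos b - Csin a * Csin b.
Proof.
unfold Ccos, Csin. rewrite Cmult_plus_distr_l, !Cexp_opp, Cexp_plus.
assert (H1 := Cexp_neq_0 (Ci * a)). assert (H2 := Cexp_neq_0 (Ci * b)).
assert (H3 := Ci_neq_0). assert (H4 := C2_neq_0).
set (x := Cexp (Ci * a)) in *. set (y := Cexp (Ci * b)) in *.
(* [field] treats [Ci] as an atom, so its square is isolated and rewritten by hand. *)
replace ((x - / x) / (2 * Ci) * ((y - / y) / (2 * Ci))) with
  ((x - / x) * (y - / y) / (2 * 2 * (Ci * Ci))) by (field; now split).
rewrite Ci2. field. repeat split; try assumption.
Qed.

Lemma Csin_plus (a b : C) : Csin (a + b) = Csin a * Ccos b + Ccos a * Csin b.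
Proof.
unfold Ccos, Csin. rewrite Cmult_plus_distr_l, !Cexp_opp, Cexp_plus.
assert (H1 := Cexp_neq_0 (Ci * a)). assert (H2 := Cexp_neq_0 (Ci * b)).
assert (H3 := Ci_neq_0). assert (H4 := C2_neq_0).
field. repeat split; assumption.
Qed.

Lemma Ccos_opp (a : C) : Ccos (- a) = Ccos a.
Proof.
unfold Ccos. replace (Ci * - a) with (- (Ci * a)) by ring.
replace (- - (Ci * a)) with (Ci * a) by ring. f_equal. ring.
Qed.

Lemma Csin_opp (a : C) : Csin (- a) = - Csin a.
Proof.
unfold Csin. replace (Ci * - a) with (- (Ci * a)) by ring.
replace (- - (Ci * a)) with (Ci * a) by ring.
unfold Cdiv. ring.
Qed.

Lemma Ccos_0 : Ccos 0 = 1.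
Proof.
unfold Ccos. replace (Ci * 0) with (RtoC 0) by ring.
rewrite Cexp_opp, Cexp_0. field.
Qed.

Lemma Csin_0 : Csin 0 = 0.
Proof.
unfold Csin. replace (Ci * 0) with (RtoC 0) by ring.
rewrite Cexp_opp, Cexp_0. field; exact Ci_neq_0.
Qed.

Lemma cderive_Cexp_lin (k z : C) : cderive (fun t => Cexp (k * t)) z (k * Cexp (k * z)).
Proof.
refine (cderive_eq _ _ _ _ (cderive_comp Cexp (fun t => k * t) z _ _ (cderive_Cexp _)
  (cderive_mult _ _ _ _ _ (cderive_const k z) (cderive_id z))) _). ring.
Qed.

Lemma cderive_Cexp_Ci (z : C) :
  cderive (fun t => Cexp (Ci * t)) z (Ci * Cexp (Ci * z)) /\
  cderive (fun t => Cexp (- (Ci * t))) z (- Ci * Cexp (- (Ci * z))).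
Proof.
split; [apply cderive_Cexp_lin|].
apply cderive_ext_loc with (f := fun t => Cexp (- Ci * t)).
- apply filter_forall. intros t. f_equal. ring.
- replace (- (Ci * z)) with (- Ci * z) by ring. apply cderive_Cexp_lin.
Qed.

Lemma cderive_Csin (z : C) : cderive Csin z (Ccos z).
Proof.
destruct (cderive_Cexp_Ci z) as [H1 H2].
assert (H3 : 2 * Ci <> 0) by (apply Cmult_neq_0; [apply C2_neq_0 | apply Ci_neq_0]).
assert (H := cderive_div _ _ _ _ _ (cderive_minus _ _ _ _ _ H1 H2) (cderive_const (2 * Ci) z) H3).
unfold Csin. apply (cderive_eq _ _ _ _ H).
unfold Ccos. field; exact Ci_neq_0.
Qed.

Lemma cderive_Ccos (z : C) : cderive Ccos z (- Csin z).
Proof.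
destruct (cderive_Cexp_Ci z) as [H1 H2].
assert (H := cderive_div _ _ _ _ _ (cderive_plus _ _ _ _ _ H1 H2) (cderive_const 2 z) C2_neq_0).
unfold Ccos. apply (cderive_eq _ _ _ _ H).
unfold Csin.
replace ((Cexp (Ci * z) - Cexp (- (Ci * z))) / (2 * Ci)) with
  (Ci * (Cexp (Ci * z) - Cexp (- (Ci * z))) / (2 * (Ci * Ci)))
  by (field; exact Ci_neq_0).
rewrite Ci2. field.
Qed.

Lemma cderive_Ctan (z : C) : Ccos z <> 0 -> cderive Ctan z (1 + Ctan z * Ctan z).
Proof.
intros Hz.
assert (H := cderive_div _ _ _ _ _ (cderive_Csin z) (cderive_Ccos z) Hz).
unfold Ctan. apply (cderive_eq _ _ _ _ H).
field. exact Hz.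
Qed.

Lemma Ctan_0 : Ctan 0 = 0.
Proof. unfold Ctan. rewrite Csin_0, Ccos_0. field; apply C1_nz. Qed.

Lemma Ctan_opp (z : C) : Ctan_dom z -> Ctan (- z) = - Ctan z.
Proof. intros Hz. unfold Ctan. rewrite Csin_opp, Ccos_opp. field. exact Hz. Qed.

Lemma Ctan_plus (a b : C) : Ctan_dom a -> Ctan_dom b -> Ctan_dom (a + b) ->
  Ctan (a + b) * (1 - Ctan a * Ctan b) = Ctan a + Ctan b.
Proof.
unfold Ctan_dom. intros Ha Hb Hab. unfold Ctan.
rewrite Csin_plus. rewrite Ccos_plus in Hab |- *. field. repeat split; assumption.
Qed.

Lemma Ctan_dom_loc (z : C) : Ctan_dom z -> loc z Ctan_dom.
Proof.
intros Hz. apply (tends_neq _ _ (Ccos z)); [|exact Hz].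
exact (cderive_continuous _ _ _ (cderive_Ccos z)).
Qed.

(** * The exponential flow *)

Lemma Copp_neq_0 (a : C) : a <> 0 -> - a <> 0.
Proof. intros Ha E. apply Ha. replace a with (- - a) by ring. rewrite E. ring. Qed.

Lemma Cdiv_neq_0 (a b : C) : a <> 0 -> b <> 0 -> a / b <> 0.
Proof.
intros Ha Hb E. apply Ha. replace a with (a / b * b) by (field; exact Hb).
rewrite E. ring.
Qed.

(** For every [f] the terms (a - b) f (a + b) cancel in u(a, b) + u(b, a), so the sum of coordinates
    is preserved. The outer [f] is therefore taken at (1 - z) (x + y), while the difference of
    coordinates collects both factors. *)
Lemma u_exp_iterate (f : C -> C) (x y z : C) : z <> 0 ->
  u_exp f ((1 - z) / z * u_exp f (z * x) (z * y)) ((1 - z) / z * u_exp f (z * y) (z * x)) =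
  / 2 * (1 - z) * ((x - y) * (f (z * (x + y)) * f ((1 - z) * (x + y))) + x + y).
Proof.
intros Hz. unfold u_exp.
replace (z * y + z * x) with (z * (x + y)) by ring.
replace (z * x + z * y) with (z * (x + y)) by ring.
set (F := f (z * (x + y))).
match goal with |- context [f (?a / z * ?b + ?c)] =>
  replace (a / z * b + c) with ((1 - z) * (x + y)) by (field; exact Hz) end.
field; exact Hz.
Qed.

Lemma exp_translation (f : C -> C) :
  exp_addition_formula f -> projective_translation_equation everywhere (phi_exp f).
Proof.
intros H [x y] z Hz _ _ _. unfold scale, phi_exp; simpl fst; simpl snd.
rewrite !u_exp_iterate, <- !H by exact Hz.
replace (z * (x + y) + (1 - z) * (x + y)) with (x + y) by ring.
replace (z * (y + x) + (1 - z) * (y + x)) with (y + x) by ring.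
unfold u_exp. apply injective_projections; simpl fst; simpl snd; ring.
Qed.

Lemma u_exp_tends (f : C -> C) (x y : C) :
  filterlim (fun z => / z * u_exp f (z * x) (z * y)) (loc' 0) (loc x) <->
  filterlim (fun z => / 2 * ((x - y) * f (z * (x + y)) + (x + y))) (loc' 0) (loc x).
Proof.
assert (E : loc' 0 (fun z => / z * u_exp f (z * x) (z * y) =
   / 2 * ((x - y) * f (z * (x + y)) + (x + y)))).
{ generalize (loc'_neq 0). apply filter_imp. intros z Hz. unfold u_exp.
  replace (z * x + z * y) with (z * (x + y)) by ring. field; exact Hz. }
split; apply filterlim_ext_loc; revert E; apply filter_imp; intros; congruence.
Qed.

Lemma exp_addition (f : C -> C) :
  projective_flow everywhere (phi_exp f) -> exp_addition_formula f.
Proof.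
intros [HT HB].
(* At the point (a + b, 0) with z = a / (a + b) the two arguments of [f] are a and b. The three
   conditions ensure z <> 0, 1 - z <> 0 and a nonzero denominator. *)
assert (Hmul : forall a b : C, a <> 0 -> b <> 0 -> a + b <> 0 -> f (a + b) = f a * f b).
{ intros a b Ha Hb Hab.
  assert (Hz : a / (a + b) <> 0) by (apply Cdiv_neq_0; assumption).
  assert (H := f_equal fst (HT (a + b, RtoC 0) _ Hz I I I)).
  unfold scale, phi_exp in H; simpl fst in H; simpl snd in H.
  rewrite u_exp_iterate in H by exact Hz.
  replace (a / (a + b) * (a + b + 0)) with a in H by (field; exact Hab).
  replace ((1 - a / (a + b)) * (a + b + 0)) with b in H by (field; exact Hab).
  unfold u_exp in H. rewrite !Cplus_0_r in H.
  replace (f (a + b)) with ((2 * ((1 - a / (a + b)) *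
    (/ 2 * ((a + b - 0) * f (a + b) + (a + b)))) / b) - 1) by (field; split; assumption).
  rewrite H. field. split; assumption. }
(* The point ((s + 1) / 2, (s - 1) / 2) has coordinate sum s and difference 1, so the boundary
   condition there isolates f (z s). *)
assert (Hlim : forall s : C, filterlim (fun z => f (z * s)) (loc' 0) (loc 1)).
{ intros s.
  assert (H := proj2 (HB ((s + 1) / 2, (s - 1) / 2))). apply tends_pair in H; [|typeclasses eauto].
  apply proj1 in H. unfold scale, phi_exp in H; simpl fst in H; simpl snd in H.
  apply (u_exp_tends f ((s + 1) / 2) ((s - 1) / 2)) in H.
  replace ((s + 1) / 2 - (s - 1) / 2) with (RtoC 1) in H by field.
  replace ((s + 1) / 2 + (s - 1) / 2) with s in H by field.
  apply filterlim_ext with (f := fun z : C => 2 * (/ 2 * (1 * f (z * s) + s)) - s).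
  - intros z. field.
  - apply tends_eq with (a := 2 * ((s + 1) / 2) - s); [tends; exact H | field]. }
assert (H0 : f 0 = 1).
{ assert (H := Hlim 0).
  apply (filterlim_locally_unique (K := C_AbsRing) (V := C_NormedModule)
     (F := loc' 0) (fun z => f (z * 0))); [|exact H].
  apply filterlim_ext with (f := fun _ : C => f 0); [intros z; f_equal; ring|].
  tends. }
intros a b.
destruct (Ceq_dec a 0) as [->|Ha]; [rewrite H0, Cplus_0_l; ring|].
destruct (Ceq_dec b 0) as [->|Hb]; [rewrite H0, Cplus_0_r; ring|].
destruct (Ceq_dec (a + b) 0) as [E|Hab]; [|now apply Hmul].
assert (Hb' : b = - a) by (replace b with (a + b - a) by ring; rewrite E; ring).
subst b. rewrite E, H0.
(* The case b = - a is reached through a third argument: f (z a) = f (z a + a) f (- a) = f (z a) f a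
   f (- a), and [Hlim] lets f (z a) be cancelled for small z. *)
assert (H1 := tends_neq _ _ 1 0 (Hlim a) C1_nz).
assert (H2 : loc' 0 (fun z => z * a + a <> 0)).
{ apply (tends_neq _ _ (0 * a + a)); [tends; apply tends_id'|].
  now replace (0 * a + a) with a by ring. }
destruct (filter_ex (F := loc' 0) _ (filter_and _ _ (loc'_neq 0) (filter_and _ _ H1 H2)))
  as [z [Hz [Hf Hs]]].
assert (Hza : z * a <> 0) by now apply Cmult_neq_0.
assert (E1 := Hmul (z * a + a) (- a) Hs Hb).
replace (z * a + a + - a) with (z * a) in E1 by ring.
rewrite (Hmul (z * a) a Hza Ha Hs) in E1. specialize (E1 Hza).
replace (f a * f (- a)) with (f (z * a) * f a * f (- a) / f (z * a)) by (field; exact Hf).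
rewrite <- E1. field; exact Hf.
Qed.

Lemma exp_boundary (f : C -> C) :
  filterlim f (loc 0) (loc 1) -> boundary_condition everywhere (phi_exp f).
Proof.
intros Hf [x y]. split; [apply filter_forall; intros; exact I|].
assert (H : forall a b : C, filterlim (fun z => / z * u_exp f (z * a) (z * b)) (loc' 0) (loc a)).
{ intros a b. apply u_exp_tends.
  apply tends_eq with (a := / 2 * ((a - b) * 1 + (a + b))); [tends | field].
  apply (filterlim_comp _ _ _ (fun z => z * (a + b)) f _ (loc 0)); [|exact Hf].
  apply tends_eq with (a := 0 * (a + b)); [tends; apply tends_id' | ring]. }
apply tends_pair; [typeclasses eauto|]. split; apply H.
Qed.

Lemma exp_pde : solves_pde (fun _ _ => True) (u_exp Cexp) varpi_exp varrho_exp.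
Proof.
intros x y _.
assert (Hx : cderive (fun t => t + y) x 1).
{ refine (cderive_eq _ _ _ _ (cderive_plus _ _ _ _ _ (cderive_id x) (cderive_const y x)) _). ring. }
assert (Hy : cderive (fun t => x + t) y 1).
{ refine (cderive_eq _ _ _ _ (cderive_plus _ _ _ _ _ (cderive_const x y) (cderive_id y)) _). ring. }
(* Differentiating along a curve (a t, b t) yields both partial derivatives from one computation. *)
assert (H : forall (a b : C -> C) (t a' b' : C), cderive a t a' -> cderive b t b' ->
  cderive (fun t => u_exp Cexp (a t) (b t)) t
    (/ 2 * ((a' - b') * Cexp (a t + b t) + (a t - b t) * ((a' + b') * Cexp (a t + b t)) + a' + b'))).
{ intros a b t a' b' Ha Hb. unfold u_exp.
  assert (H1 := cderive_minus _ _ _ _ _ Ha Hb).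
  assert (H2 := cderive_comp Cexp (fun t => a t + b t) _ _ _ (cderive_Cexp _) (cderive_plus _ _ _ _ _ Ha Hb)).
  assert (H3 := cderive_plus _ _ _ _ _ (cderive_plus _ _ _ _ _ (cderive_mult _ _ _ _ _ H1 H2) Ha) Hb).
  refine (cderive_eq _ _ _ _ (cderive_mult _ _ _ _ _ (cderive_const (/ 2) t) H3) _). ring. }
eexists; eexists. split; [|split].
- exact (H (fun t => t) (fun _ => y) x _ _ (cderive_id x) (cderive_const y x)).
- exact (H (fun _ => x) (fun t => t) y _ _ (cderive_const x y) (cderive_id y)).
- unfold varrho_exp, varpi_exp, u_exp. field.
Qed.

(** * The tangent flow and the addition formula *)

Ltac neq H := let E := fresh in intros E; apply H; rewrite <- E; ring.

Lemma u_tan_off_line (f : C -> C) (c x y : C) : x + y <> 0 ->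
  u_tan f c x y = ((x + y) * x + (x + y) * y * f (x + y)) / (x + y + (y - x) * f (x + y)).
Proof. intros H. unfold u_tan. now destruct (Ceq_dec (x + y) 0). Qed.

Lemma u_tan_on_line (f : C -> C) (c x y : C) : x + y = 0 ->
  u_tan f c x y = x / (1 + c * (y - x)).
Proof. intros H. unfold u_tan. now destruct (Ceq_dec (x + y) 0). Qed.

Lemma u_tan_dom_off_line (D : C -> Prop) (f : C -> C) (c x y : C) : x + y <> 0 ->
  (u_tan_dom D f c x y <-> D (x + y) /\ x + y + (y - x) * f (x + y) <> 0).
Proof. intros H. unfold u_tan_dom. now destruct (Ceq_dec (x + y) 0). Qed.

Lemma u_tan_dom_on_line (D : C -> Prop) (f : C -> C) (c x y : C) : x + y = 0 ->
  (u_tan_dom D f c x y <-> D (x + y) /\ 1 + c * (y - x) <> 0).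
Proof. intros H. unfold u_tan_dom. now destruct (Ceq_dec (x + y) 0). Qed.

(** The value f (- (x + y)) is kept as it stands, because oddness is not yet known when the flow is
    the hypothesis. *)
Lemma phi_tan_anti_off_line (f : C -> C) (c x y : C) : x + y <> 0 ->
  x + y + (y - x) * f (x + y) <> 0 -> x + y - (y - x) * f (- (x + y)) <> 0 ->
  phi_tan_anti f c (x, y) =
    ((x + y) * (x + y * f (x + y)) / (x + y + (y - x) * f (x + y)),
     (x + y) * (y + x * f (- (x + y))) / (x + y - (y - x) * f (- (x + y)))).
Proof.
intros H N1 N2. unfold phi_tan_anti; simpl fst; simpl snd.
assert (E : - y + - x = - (x + y)) by ring.
assert (H' : - y + - x <> 0) by (rewrite E; now apply Copp_neq_0).
rewrite !u_tan_off_line by assumption. rewrite E.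
f_equal; field.
- exact N1.
- split; [exact N2|]. intros F; apply N2.
  match type of F with ?a = _ => replace (x + y - (y - x) * f (- (x + y))) with (- a) by ring end.
  rewrite F; ring.
Qed.

Lemma phi_tan_anti_on_line (f : C -> C) (c x y : C) : x + y = 0 ->
  phi_tan_anti f c (x, y) = (x / (1 + c * (y - x)), y / (1 + c * (y - x))).
Proof.
intros H. unfold phi_tan_anti; simpl fst; simpl snd.
assert (H' : - y + - x = 0) by (replace (- y + - x) with (- (x + y)) by ring; rewrite H; ring).
rewrite !u_tan_on_line by assumption.
f_equal. replace (- x - - y) with (y - x) by ring. unfold Cdiv; ring.
Qed.

Lemma phi_tan_anti_dom_off_line (D : C -> Prop) (f : C -> C) (c x y : C) : x + y <> 0 ->
  (phi_tan_anti_dom D f c (x, y) <->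
   (D (x + y) /\ x + y + (y - x) * f (x + y) <> 0) /\
   D (- (x + y)) /\ x + y - (y - x) * f (- (x + y)) <> 0).
Proof.
intros H. unfold phi_tan_anti_dom; simpl fst; simpl snd.
assert (E : - y + - x = - (x + y)) by ring.
assert (H' : - y + - x <> 0) by (rewrite E; now apply Copp_neq_0).
rewrite !u_tan_dom_off_line, E by assumption.
assert (E2 : - (x + y) + (- x - - y) * f (- (x + y)) = - (x + y - (y - x) * f (- (x + y)))) by ring.
rewrite E2.
assert (K : forall a : C, - a <> 0 <-> a <> 0).
{ intros a. split; [|apply Copp_neq_0].
  intros A B; apply A; rewrite B; ring. }
rewrite K. tauto.
Qed.

Lemma phi_tan_anti_dom_on_line (D : C -> Prop) (f : C -> C) (c x y : C) : x + y = 0 ->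
  phi_tan_anti_dom D f c (x, y) -> 1 + c * (y - x) <> 0.
Proof. intros H [A _]. simpl in A. now apply u_tan_dom_on_line in A. Qed.

(** Put s = x + y, T = f s, T1 = f (z s), T2 = f ((1 - z) s). Wherever T1 + T2 appears in the
    composed map it is replaced by T w with w = 1 - T1 T2, and w becomes a common factor of
    numerators and denominators. That w <> 0 follows from the nonvanishing of the outer
    denominator. *)
Lemma phi_tan_anti_translation (D : C -> Prop) (f : C -> C) (c : C) :
  (forall t, D t -> f (- t) = - f t) ->
  (forall a b, D a -> D b -> D (a + b) -> f (a + b) * (1 - f a * f b) = f a + f b) ->
  projective_translation_equation (phi_tan_anti_dom D f c) (phi_tan_anti f c).
Proof.
intros Hodd Hadd [x y] z Hz Hp Hzp Hq.
change (scale z (x, y)) with (z * x, z * y) in *.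
destruct (Ceq_dec (x + y) 0) as [Hs|Hs].
(* On x + y = 0 no addition formula enters: p -> p / (1 + c (y - x)) satisfies the equation
   identically. *)
- assert (Hzs : z * x + z * y = 0) by (replace (z * x + z * y) with (z * (x + y)) by ring; rewrite Hs; ring).
  assert (M1 := phi_tan_anti_dom_on_line _ _ _ _ _ Hs Hp).
  assert (M2 := phi_tan_anti_dom_on_line _ _ _ _ _ Hzs Hzp).
  rewrite (phi_tan_anti_on_line f c _ _ Hs).
  rewrite (phi_tan_anti_on_line f c _ _ Hzs) in Hq |- *. unfold scale in *; simpl fst in *; simpl snd in *.
  assert (Hqs : (1 - z) / z * (z * x / (1 + c * (z * y - z * x))) +
     (1 - z) / z * (z * y / (1 + c * (z * y - z * x))) = 0).
  { transitivity ((1 - z) * (x + y) / (1 + c * (z * y - z * x))); [field; now split|].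
    rewrite Hs. field. exact M2. }
  assert (M3 := phi_tan_anti_dom_on_line _ _ _ _ _ Hqs Hq).
  rewrite (phi_tan_anti_on_line f c _ _ Hqs).
  match type of M3 with ?a <> RtoC 0 =>
    assert (E : a = (1 + c * (y - x)) / (1 + c * (z * y - z * x))) by (field; now split) end.
  rewrite E. apply injective_projections; simpl fst; simpl snd; field; repeat split; assumption.
- assert (Hzs : z * x + z * y <> 0) by (replace (z * x + z * y) with (z * (x + y)) by ring; now apply Cmult_neq_0).
  apply phi_tan_anti_dom_off_line in Hp; [|exact Hs].
  destruct Hp as [[D1 N1] [D1' N1']].
  apply phi_tan_anti_dom_off_line in Hzp; [|exact Hzs].
  destruct Hzp as [[D2 N2] [D2' N2']].
  rewrite (phi_tan_anti_off_line f c _ _ Hs N1 N1').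
  rewrite (phi_tan_anti_off_line f c _ _ Hzs N2 N2') in Hq |- *. unfold scale in *; simpl fst in *; simpl snd in *.
  clear N1' N2' D1' D2'.
  rewrite !Hodd in * by assumption.
  set (T := f (x + y)) in *. set (T1 := f (z * x + z * y)) in *.
  assert (N2a : x + y + (y - x) * T1 <> 0).
  { intros E; apply N2. replace (z * x + z * y + (z * y - z * x) * T1) with (z * (x + y + (y - x) * T1)) by ring.
    rewrite E; ring. }
  match type of Hq with phi_tan_anti_dom _ _ _ (?a, ?b) =>
    assert (E1 : a = (1 - z) * (x + y) * (x + y * T1) / (x + y + (y - x) * T1));
    [|assert (E2 : b = (1 - z) * (x + y) * (y - x * T1) / (x + y + (y - x) * T1))] end.
  { field; now repeat split. }
  { field; repeat split; try assumption. neq N2. }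
  rewrite E1, E2 in Hq |- *. clear E1 E2 Hzs N2.
  set (q1 := (1 - z) * (x + y) * (x + y * T1) / (x + y + (y - x) * T1)) in *.
  set (q2 := (1 - z) * (x + y) * (y - x * T1) / (x + y + (y - x) * T1)) in *.
  assert (Es : q1 + q2 = (1 - z) * (x + y)) by (unfold q1, q2; field; assumption).
  (* For z = 1 the iterate starts at the origin, which belongs to the other branch of [u_tan]; both
     sides vanish. *)
  destruct (Ceq_dec (1 - z) 0) as [Hz1|Hz1].
  + assert (Hqs : q1 + q2 = 0) by (rewrite Es, Hz1; ring).
    rewrite (phi_tan_anti_on_line f c _ _ Hqs).
    replace q1 with (RtoC 0) by (unfold q1; rewrite Hz1; unfold Cdiv; ring).
    replace q2 with (RtoC 0) by (unfold q2; rewrite Hz1; unfold Cdiv; ring).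
    rewrite Hz1. apply injective_projections; simpl fst; simpl snd; unfold Cdiv; ring.
  + assert (Hqs : q1 + q2 <> 0) by (rewrite Es; now apply Cmult_neq_0).
    apply phi_tan_anti_dom_off_line in Hq; [|exact Hqs].
    destruct Hq as [[D3 N3] [D3' N3']].
    rewrite (phi_tan_anti_off_line f c _ _ Hqs N3 N3').
    rewrite !Hodd by assumption. clear D3' N3'.
    rewrite Es in *.
    set (T2 := f ((1 - z) * (x + y))) in *.
    assert (HT : T * (1 - T1 * T2) = T1 + T2).
    { unfold T, T1, T2. rewrite <- Hadd; try assumption.
      - do 2 f_equal. ring.
      - now replace (z * x + z * y + (1 - z) * (x + y)) with (x + y) by ring. }
    set (w := 1 - T1 * T2) in *.
    assert (EN : (1 - z) * (x + y) + (q2 - q1) * T2 =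
      (1 - z) * (x + y) * (w * (x + y + (y - x) * T)) / (x + y + (y - x) * T1)).
    { transitivity ((1 - z) * (x + y) * ((x + y) * w + (y - x) * (T1 + T2)) / (x + y + (y - x) * T1)).
      - unfold q1, q2, w. field; assumption.
      - rewrite <- HT. field; assumption. }
    assert (Hw : w <> 0).
    { intros E. apply N3. rewrite EN, E. field; assumption. }
    assert (EM1 : q1 + q2 * T2 = (1 - z) * (x + y) * (w * (x + y * T)) / (x + y + (y - x) * T1)).
    { transitivity ((1 - z) * (x + y) * (x * w + y * (T1 + T2)) / (x + y + (y - x) * T1)).
      - unfold q1, q2, w. field; assumption.
      - rewrite <- HT. field; assumption. }
    assert (EM2 : q2 + q1 * - T2 = (1 - z) * (x + y) * (w * (y - x * T)) / (x + y + (y - x) * T1)).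
    { transitivity ((1 - z) * (x + y) * (y * w - x * (T1 + T2)) / (x + y + (y - x) * T1)).
      - unfold q1, q2, w. field; assumption.
      - rewrite <- HT. field; assumption. }
    replace ((1 - z) * (x + y) - (q2 - q1) * - T2) with ((1 - z) * (x + y) + (q2 - q1) * T2) by ring.
    rewrite EN, EM1, EM2. clearbody w.
    apply injective_projections; simpl fst; simpl snd; field; repeat split; assumption.
Qed.

(** * The boundary condition of the tangent flow *)

Lemma tends_continuous_at_0 (f : C -> C) (a s : C) :
  filterlim f (loc 0) (loc a) -> filterlim (fun z => f (z * s)) (loc' 0) (loc a).
Proof.
intros Hf. apply (filterlim_comp _ _ _ (fun z => z * s) f _ (loc 0)); [|exact Hf].
apply tends_eq with (a := 0 * s); [tends; apply tends_id' | ring].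
Qed.

Lemma loc'_scale (P : C -> Prop) (s : C) : loc 0 P -> loc' 0 (fun z => P (z * s)).
Proof.
intros HP. apply (tends_eq (loc' 0) (fun z => z * s) (0 * s) 0); [tends; apply tends_id' | ring | exact HP].
Qed.

(** For z <> 0 the point (z x, z y) lies on x + y = 0 exactly when (x, y) does. So each ray stays in
    one branch of [u_tan], and z cancels there. *)
Lemma u_tan_boundary (D : C -> Prop) (f : C -> C) (c : C) :
  loc 0 D -> filterlim f (loc 0) (loc 0) -> forall x y : C,
  loc' 0 (fun z => u_tan_dom D f c (z * x) (z * y)) /\
  filterlim (fun z => / z * u_tan f c (z * x) (z * y)) (loc' 0) (loc x).
Proof.
intros HD Hf x y.
assert (HDs := loc'_scale D (x + y) HD).
assert (Hsum : forall z, z * x + z * y = z * (x + y)) by (intros; ring).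
destruct (Ceq_dec (x + y) 0) as [Hs|Hs].
- assert (Hzs : forall z, z * x + z * y = 0) by (intros z; rewrite Hsum, Hs; ring).
  assert (HN : filterlim (fun z => 1 + c * (z * y - z * x)) (loc' 0) (loc 1)).
  { apply tends_eq with (a := 1 + c * (0 * y - 0 * x)); [tends; apply tends_id' | ring]. }
  split.
  + generalize (filter_and _ _ HDs (tends_neq _ _ _ _ HN C1_nz)). apply filter_imp.
    intros z [H1 H2]. apply u_tan_dom_on_line; [apply Hzs|]. now rewrite Hsum.
  + apply filterlim_ext_loc with (f := fun z => x / (1 + c * (z * y - z * x))).
    * generalize (filter_and _ _ (loc'_neq 0) (tends_neq _ _ _ _ HN C1_nz)).
      apply filter_imp. intros z [H1 H2]. rewrite u_tan_on_line by apply Hzs.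
      field. split; assumption.
    * apply tends_eq with (a := x / 1); [tends; [exact C1_nz | exact HN] | field].
- assert (Hfs := tends_continuous_at_0 f 0 (x + y) Hf).
  assert (HN : filterlim (fun z => x + y + (y - x) * f (z * (x + y))) (loc' 0) (loc (x + y))).
  { apply tends_eq with (a := x + y + (y - x) * 0); [tends; exact Hfs | ring]. }
  assert (HNz := tends_neq _ _ _ _ HN Hs).
  split.
  + generalize (filter_and _ _ HDs (filter_and _ _ (loc'_neq 0) HNz)). apply filter_imp.
    intros z [H1 [H2 H3]]. apply u_tan_dom_off_line; rewrite Hsum.
    * now apply Cmult_neq_0.
    * split; [exact H1|].
      replace (z * (x + y) + (z * y - z * x) * f (z * (x + y))) with
        (z * (x + y + (y - x) * f (z * (x + y)))) by ring.
      now apply Cmult_neq_0.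
  + apply filterlim_ext_loc with
      (f := fun z => (x + y) * (x + y * f (z * (x + y))) / (x + y + (y - x) * f (z * (x + y)))).
    * generalize (filter_and _ _ (loc'_neq 0) HNz).
      apply filter_imp. intros z [H1 H2].
      rewrite u_tan_off_line; rewrite Hsum; [|now apply Cmult_neq_0].
      field. repeat split; try assumption.
      replace (z * (x + y) + (z * y - z * x) * f (z * (x + y))) with
        (z * (x + y + (y - x) * f (z * (x + y)))) by ring.
      now apply Cmult_neq_0.
    * apply tends_eq with (a := (x + y) * (x + y * 0) / (x + y + (y - x) * 0)).
      { tends; try exact Hfs. now replace (x + y + (y - x) * 0) with (x + y) by ring. }
      field. replace (x + y + (y - x) * 0) with (x + y) by ring. exact Hs.
Qed.

Lemma phi_tan_anti_boundary (D : C -> Prop) (f : C -> C) (c : C) :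
  loc 0 D -> filterlim f (loc 0) (loc 0) ->
  boundary_condition (phi_tan_anti_dom D f c) (phi_tan_anti f c).
Proof.
intros HD Hf [x y].
destruct (u_tan_boundary D f c HD Hf x y) as [A1 B1].
destruct (u_tan_boundary D f c HD Hf (- y) (- x)) as [A2 B2].
split.
- generalize (filter_and _ _ A1 A2). apply filter_imp. intros z [H1 H2].
  split; [exact H1|]. simpl.
  now replace (- (z * y)) with (z * - y) by ring; replace (- (z * x)) with (z * - x) by ring.
- apply tends_pair; [typeclasses eauto|]. split; [exact B1|].
  simpl. apply filterlim_ext with (f := fun z : C => - (/ z * u_tan f c (z * - y) (z * - x))).
  + intros z. replace (- (z * y)) with (z * - y) by ring. replace (- (z * x)) with (z * - x) by ring.
    ring.
  + apply tends_eq with (a := - - y); [tends; exact B2 | ring].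
Qed.

(** * Consequences of the addition formula for a tangent-like function *)

Lemma tends_translate (x : C) : filterlim (fun h => x + h) (loc 0) (loc x).
Proof.
apply tends_eq with (a := x + 0); [tends; apply filterlim_id | ring].
Qed.

Lemma tends_translate' (x y : C) : filterlim (fun h => y - x + h) (loc' x) (loc' y).
Proof.
intros P HP.
assert (H1 : filterlim (fun h => y - x + h) (loc' x) (loc y)).
{ apply tends_eq with (a := y - x + x); [tends; apply tends_id' | ring]. }
assert (H2 := H1 _ HP). unfold filtermap in *.
generalize (filter_and _ _ (loc'_neq x) H2). apply filter_imp.
intros h [A B]. apply B. intros E. apply A. change (@eq C h x).
replace h with (y - x + h - (y - x)) by ring. rewrite E. ring.
Qed.

Lemma cderive_tends_0 (f : C -> C) (x l : C) :
  cderive f x l <-> filterlim (fun h => (f (x + h) - f x) / h) (loc' 0) (loc l).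
Proof.
rewrite cderive_tends. split; intros H.
- apply filterlim_ext with (f := fun h : C => (f (x - 0 + h) - f x) / (x - 0 + h - x)).
  + intros h. f_equal; [do 2 f_equal|]; ring.
  + exact (filterlim_comp _ _ _ _ _ _ _ _ (tends_translate' 0 x) H).
- apply filterlim_ext with (f := fun y : C => (f (x + (0 - x + y)) - f x) / (0 - x + y)).
  + intros h. f_equal; [do 2 f_equal|]; ring.
  + exact (filterlim_comp _ _ _ _ _ _ _ _ (tends_translate' x 0) H).
Qed.

Section TangentLike.
Variables (D : C -> Prop) (f : C -> C) (c : C).
Hypothesis Hf : tangent_like D f c.

Let Dopen t (Ht : D t) : loc t D := proj1 Hf t Ht.
Let Dconn : connected D := proj1 (proj2 Hf).
Let D0 : D 0 := proj1 (proj2 (proj2 Hf)).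
Let Dopp : forall t, D t -> D (- t) := proj1 (proj2 (proj2 (proj2 Hf))).
Let fcont : forall t, D t -> filterlim f (loc t) (loc (f t)) :=
  proj1 (proj2 (proj2 (proj2 (proj2 Hf)))).
Let fder : cderive f 0 c := proj2 (proj2 (proj2 (proj2 (proj2 Hf)))).

Section AdditionFormula.
Hypothesis f0 : f 0 = 0.
Hypothesis Hadd : tan_addition_formula D f.

Let fcont0 : filterlim f (loc 0) (loc 0).
Proof. apply tends_eq with (a := f 0); [now apply fcont | exact f0]. Qed.

(** For small h the denominator is close to 1, so the formula holds without a side condition. This
    is what carries a property of [f] from a point to its neighbours. *)
Lemma addition_near (a : C) : D a ->
  loc 0 (fun h => D h /\ D (a + h) /\ 1 - f a * f h <> 0 /\
    f (a + h) = (f a + f h) / (1 - f a * f h)).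
Proof.
intros Ha.
assert (H1 : loc 0 (fun h => D (a + h))) by exact (tends_translate a _ (Dopen a Ha)).
assert (H2 : loc 0 (fun h => 1 - f a * f h <> 0)).
{ apply (tends_neq _ _ (1 - f a * 0)); [tends; exact fcont0|].
  replace (1 - f a * 0) with (RtoC 1) by ring. exact C1_nz. }
generalize (filter_and _ _ (Dopen 0 D0) (filter_and _ _ H1 H2)). apply filter_imp.
intros h [A [B E]]. repeat split; try assumption. now apply Hadd.
Qed.

Lemma loc_of_translate (P : C -> Prop) (a : C) : loc 0 (fun h => P (a + h)) -> loc a P.
Proof.
intros H.
assert (Ht : filterlim (fun t => t - a) (loc a) (loc 0)).
{ apply tends_eq with (a := a - a); [tends; apply filterlim_id | ring]. }
assert (H1 := Ht _ H). unfold filtermap in H1. revert H1. apply filter_imp. intros t Ht'.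
now replace t with (a + (t - a)) by ring.
Qed.

(** The numbers i and -i are fixed by every map w -> (w + t) / (1 - w t), so a value [j] of [f]
    would spread to a neighbourhood. *)
Lemma value_neq_i (j : C) : j * j = - (1) -> forall t, D t -> f t <> j.
Proof.
intros Hj.
assert (Hj0 : j <> 0) by (intros ->; apply C1_nz; replace (RtoC 1) with (- - (1)) by ring; rewrite <- Hj; ring).
apply (connected_subset D (fun t => f t <> j) 0 Dconn D0).
- rewrite f0. congruence.
- intros z Hz Hzj. apply filter_and; [now apply Dopen|].
  now apply (tends_neq _ _ (f z)); [apply fcont|].
- intros z Hz Hzj. apply NNPP in Hzj. apply loc_of_translate.
  generalize (addition_near z Hz). apply filter_imp.
  intros h [A [B [N E]]]. split; [exact B|]. intros K. apply K. rewrite E.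
  rewrite Hzj in *.
  replace (j + f h) with (j * (1 - j * f h)); [field; exact N|].
  transitivity (j - (j * j) * f h); [ring|]. rewrite Hj. ring.
Qed.

Lemma one_plus_square_neq_0 (t : C) : D t -> 1 + f t * f t <> 0.
Proof.
intros Ht E. apply (value_neq_i (f t)) with t; [|exact Ht|reflexivity].
replace (f t * f t) with (1 + f t * f t - 1) by ring. rewrite E. ring.
Qed.

(** Since f 0 = 0, the formula at (t, - t) forces f t + f (- t) = 0 as soon as 1 - f t f (- t) <> 0.
    Where oddness holds this denominator is 1 + (f t)^2 <> 0, and by continuity it stays nonzero
    nearby. *)
Lemma odd_of_addition (t : C) : D t -> f (- t) = - f t.
Proof.
intros Ht.
assert (H : f t + f (- t) = 0).
{ revert t Ht. apply (connected_subset D (fun t => f t + f (- t) = 0) 0 Dconn D0).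
  - replace (- 0) with (RtoC 0) by ring. rewrite f0. ring.
  - intros z Hz E.
    assert (Hopp : filterlim Copp (loc z) (loc (- z))) by (apply (tends_opp _ (fun t => t)); apply filterlim_id).
    assert (Hlim : filterlim (fun t => 1 - f t * f (- t)) (loc z) (loc (1 - f z * f (- z)))).
    { tends; [now apply fcont|].
      apply (filterlim_comp _ _ _ Copp f _ (loc (- z))); [exact Hopp | now apply fcont, Dopp]. }
    assert (HN : 1 - f z * f (- z) <> 0).
    { replace (f (- z)) with (f z + f (- z) - f z) by ring. rewrite E.
      replace (1 - f z * (0 - f z)) with (1 + f z * f z) by ring.
      now apply one_plus_square_neq_0. }
    generalize (filter_and _ _ (Dopen z Hz) (tends_neq _ _ _ _ Hlim HN)). apply filter_imp.
    intros t [Ht N]. split; [exact Ht|].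
    assert (Et : t + - t = 0) by ring.
    assert (K := Hadd t (- t) Ht (Dopp t Ht)). rewrite Et, f0 in K. specialize (K D0 N).
    replace (f t + f (- t)) with ((f t + f (- t)) / (1 - f t * f (- t)) * (1 - f t * f (- t)))
      by (field; exact N).
    rewrite <- K. ring.
  - intros z Hz E. apply filter_and; [now apply Dopen|].
    apply (tends_neq _ _ (f z + f (- z))); [|exact E]. tends; [now apply fcont|].
    apply (filterlim_comp _ _ _ Copp f _ (loc (- z))); [|now apply fcont, Dopp].
    apply (tends_opp _ (fun t => t)); apply filterlim_id. }
replace (f (- t)) with (f t + f (- t) - f t) by ring. rewrite H. ring.
Qed.

Lemma zero_of_locally_zero : loc 0 (fun h => f h = 0) -> forall t, D t -> f t = 0.
Proof.
intros H. apply (connected_subset D (fun t => f t = 0) 0 Dconn D0 f0).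
- intros z Hz E. apply loc_of_translate.
  generalize (filter_and _ _ H (addition_near z Hz)). apply filter_imp.
  intros h [E' [_ [B [_ K]]]]. split; [exact B|]. rewrite K, E, E'. field.
- intros z Hz E. apply filter_and; [now apply Dopen|].
  now apply (tends_neq _ _ (f z)); [apply fcont|].
Qed.

(* If [f a * f b = 1], the addition formula at [(a, b)] says nothing; at
   [(a, b + h)] and [(a + b, h)] it forces [f h = 0] for all small [h]. *)
Lemma addition_without_division (a b : C) : D a -> D b -> D (a + b) ->
  f (a + b) * (1 - f a * f b) = f a + f b.
Proof.
intros Ha Hb Hab.
destruct (Ceq_dec (1 - f a * f b) 0) as [E|N];
  [|rewrite Hadd by assumption; field; exact N].
exfalso.
assert (E1 : f a * f b = 1) by (replace (f a * f b) with (1 - (1 - f a * f b)) by ring; rewrite E; ring).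
assert (HS : f a + f b <> 0).
{ intros ES. apply (one_plus_square_neq_0 a Ha).
  replace (f a * f a) with (f a * (f a + f b) - f a * f b) by ring. rewrite ES, E1. ring. }
apply C1_nz. rewrite <- E1.
rewrite (zero_of_locally_zero) with (t := a); [ring| |exact Ha].
generalize (filter_and _ _ (addition_near b Hb) (addition_near (a + b) Hab)). apply filter_imp.
intros h [[Dh [Dbh [Nb Kb]]] [_ [Dabh [Nab Kab]]]].
assert (Nt := one_plus_square_neq_0 h Dh).
set (t := f h) in *.
assert (Eb : f (b + h) * (1 - f b * t) = f b + t) by (rewrite Kb; field; exact Nb).
assert (Eab : f (a + b + h) * (1 - f (a + b) * t) = f (a + b) + t) by (rewrite Kab; field; exact Nab).
destruct (Ceq_dec (1 - f a * f (b + h)) 0) as [E2|N2].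
(* Here f (b + h) = f b, as both are inverse to f a. Adding h leaves the value f b fixed, which
   forces t = 0 because f b is not i or -i. *)
- assert (E3 : (f a + f b) * t = 0).
  { replace ((f a + f b) * t) with
      (f a * (f b + t) - (1 - f b * t) + (1 - f a * f b)) by ring.
    rewrite <- Eb, E.
    replace (f a * (f (b + h) * (1 - f b * t)) - (1 - f b * t) + 0) with
      (- ((1 - f a * f (b + h)) * (1 - f b * t))) by ring.
    rewrite E2. ring. }
  replace t with ((f a + f b) * t / (f a + f b)) by (field; exact HS).
  rewrite E3. field. exact HS.
(* Formally f a f b = 1 means that the tangent of the sum is infinite, so the formula at (a, b + h)
   gives F' t = -1. With the finite value f (a + b), the formula at (a + b, h) then leaves 1 + t^2 =
   0. *)
- exfalso. apply Nt.
  assert (K := Hadd a (b + h) Ha Dbh).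
  replace (a + (b + h)) with (a + b + h) in K by ring. specialize (K Dabh N2).
  assert (E3 : f (a + b + h) * (1 - f a * f (b + h)) = f a + f (b + h)) by (rewrite K; field; exact N2).
  set (F' := f (a + b + h)) in *. set (B' := f (b + h)) in *.
  assert (E4 : (f a + f b) * (F' * t + 1) = 0).
  { replace ((f a + f b) * (F' * t + 1)) with
      (F' * (f a * (f b + t) - (1 - f b * t)) + F' * (1 - f a * f b)
       + f a * (1 - f b * t) + (f b + t) - t * (1 - f a * f b)) by ring.
    rewrite <- Eb, E.
    replace (F' * (f a * (B' * (1 - f b * t)) - (1 - f b * t)) + F' * 0 +
      f a * (1 - f b * t) + B' * (1 - f b * t) - t * 0) with
      ((1 - f b * t) * (f a + B' - F' * (1 - f a * B'))) by ring.
    rewrite E3. ring. }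
  assert (E5 : F' * t + 1 = 0).
  { replace (F' * t + 1) with ((f a + f b) * (F' * t + 1) / (f a + f b)) by (field; exact HS).
    rewrite E4. field. exact HS. }
  replace (1 + t * t) with ((F' * t + 1) * (1 - f (a + b) * t)
    - t * (F' * (1 - f (a + b) * t) - (f (a + b) + t))) by ring.
  rewrite Eab, E5. ring.
Qed.
End AdditionFormula.
End TangentLike.

(** * From the flow to oddness and the addition formula *)

Lemma phi_tan_anti_diag (f : C -> C) (c t : C) : t <> 0 ->
  phi_tan_anti f c (t / 2, t / 2) = (t / 2 * (1 + f t), t / 2 * (1 + f (- t))).
Proof.
intros Ht. assert (E : t / 2 + t / 2 = t) by field.
rewrite phi_tan_anti_off_line; rewrite E; [|exact Ht| |].
- replace (t / 2 - t / 2) with (RtoC 0) by ring. rewrite !Cmult_0_l.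
  apply injective_projections; simpl fst; simpl snd; field; try neq Ht.
- replace (t / 2 - t / 2) with (RtoC 0) by ring. neq Ht.
- replace (t / 2 - t / 2) with (RtoC 0) by ring. neq Ht.
Qed.

(** On the diagonal both denominators reduce to t whatever [f] is. Hence the flow can be evaluated
    there with no information on [f], and it displays f t and f (- t) directly. *)
Lemma phi_tan_anti_dom_diag (D : C -> Prop) (f : C -> C) (c t : C) :
  t <> 0 -> D t -> D (- t) -> phi_tan_anti_dom D f c (t / 2, t / 2).
Proof.
intros H H1 H2. assert (E : t / 2 + t / 2 = t) by field.
assert (E0 : t / 2 - t / 2 = 0) by ring.
apply phi_tan_anti_dom_off_line; rewrite E; [exact H|]. rewrite E0.
repeat split; try assumption; neq H.
Qed.

Lemma f0_of_boundary (D : C -> Prop) (f : C -> C) (c : C) : tangent_like D f c ->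
  boundary_condition (phi_tan_anti_dom D f c) (phi_tan_anti f c) -> f 0 = 0.
Proof.
intros [_ [_ [D0 [_ [fcont _]]]]] HB.
(* At (1/2, 1/2) the first component of the rescaled map is (1 + f z) / 2, so the boundary condition
   sends f z to 0. *)
assert (H := proj2 (HB (/ 2, / 2))).
apply tends_pair in H; [|typeclasses eauto]. apply proj1 in H.
apply (filterlim_locally_unique (K := C_AbsRing) (V := C_NormedModule) (F := loc' 0) f).
- intros P HP. apply loc_loc'. now apply fcont.
- apply filterlim_ext_loc with (f := fun z : C => 2 * (fst (scale (/ z) (phi_tan_anti f c (scale z (/ 2, / 2))))) - 1).
  + generalize (loc'_neq 0). apply filter_imp. intros z Hz.
    replace (scale z (/ 2, / 2)) with (z / 2, z / 2) by reflexivity.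
    rewrite phi_tan_anti_diag by exact Hz. simpl fst. field. exact Hz.
  + apply tends_eq with (a := 2 * / 2 - 1); [tends; exact H | field].
Qed.

Section FlowOfTangentLike.
Variables (D : C -> Prop) (f : C -> C) (c : C).
Hypothesis Hf : tangent_like D f c.
Hypothesis Hflow : projective_flow (phi_tan_anti_dom D f c) (phi_tan_anti f c).

Let Dopen t (Ht : D t) : loc t D := proj1 Hf t Ht.
Let Dconn : connected D := proj1 (proj2 Hf).
Let D0 : D 0 := proj1 (proj2 (proj2 Hf)).
Let Dopp : forall t, D t -> D (- t) := proj1 (proj2 (proj2 (proj2 Hf))).
Let fcont : forall t, D t -> filterlim f (loc t) (loc (f t)) :=
  proj1 (proj2 (proj2 (proj2 (proj2 Hf)))).
Let fder : cderive f 0 c := proj2 (proj2 (proj2 (proj2 (proj2 Hf)))).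

(** This is the translation equation on the diagonal with z = t / (t + h): after time t, the
    remaining time h starts from w = phi (t/2, t/2) / t. It reduces an increment at t to the
    behaviour of the flow near 0 in the fixed direction w. *)
Lemma iterate_sum (t h : C) : t <> 0 -> h <> 0 -> t + h <> 0 -> D t -> D (t + h) ->
  let w := ((1 + f t) / 2, (1 + f (- t)) / 2) in
  phi_tan_anti_dom D f c (scale h w) ->
  f (t + h) + f (- (t + h)) =
    2 * (fst (phi_tan_anti f c (scale h w)) + snd (phi_tan_anti f c (scale h w))) / h - 2.
Proof.
intros Ht Hh Hth Dt Dth w Hw.
assert (Hz : t / (t + h) <> 0) by now apply Cdiv_neq_0.
assert (H := proj1 Hflow ((t + h) / 2, (t + h) / 2) _ Hz).
assert (E1 : scale (t / (t + h)) ((t + h) / 2, (t + h) / 2) = (t / 2, t / 2)).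
{ apply injective_projections; simpl; field; exact Hth. }
rewrite E1, !phi_tan_anti_diag in H by assumption.
assert (E2 : scale ((1 - t / (t + h)) / (t / (t + h))) (t / 2 * (1 + f t), t / 2 * (1 + f (- t)))
  = scale h w).
{ apply injective_projections; simpl fst; simpl snd; field; split; assumption. }
rewrite E2 in H. rewrite <- H; try assumption.
- simpl fst; simpl snd. field. split; assumption.
- apply phi_tan_anti_dom_diag; auto.
- apply phi_tan_anti_dom_diag; auto.
Qed.

Let f0_of_flow : f 0 = 0 := f0_of_boundary D f c Hf (proj2 Hflow).

(** With w = (x, y) and s = x + y <> 0, the numerator is a factor h s (x^2 + y^2) over nonvanishing
    denominators times f (h s) + f (- h s). Differentiability at 0 alone makes the last sum o(h),
    since c s and - c s cancel. For s = 0 the component sum is 0 on both sides. *)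
Lemma phi_tan_anti_sum_tends (w : C * C) :
  filterlim (fun h => (fst (phi_tan_anti f c (scale h w)) + snd (phi_tan_anti f c (scale h w))
    - h * (fst w + snd w)) / (h * h)) (loc' 0) (loc 0).
Proof.
destruct w as [x y]. simpl (fst (x, y)); simpl (snd (x, y)).
assert (Hdom := proj1 (proj2 Hflow (x, y))).
destruct (Ceq_dec (x + y) 0) as [Hs|Hs].
- apply filterlim_ext with (f := fun _ : C => RtoC 0); [|tends].
  intros h. unfold scale. rewrite phi_tan_anti_on_line.
  + simpl fst; simpl snd. unfold Cdiv.
    replace (h * x * / (1 + c * (h * y - h * x)) + h * y * / (1 + c * (h * y - h * x)) - h * (x + y))
     with ((x + y) * (h * / (1 + c * (h * y - h * x)) - h)) by ring.
    rewrite Hs. ring.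
  + simpl. replace (h * x + h * y) with (h * (x + y)) by ring. rewrite Hs. ring.
- set (s := x + y) in *.
  assert (Hc0 : filterlim f (loc 0) (loc 0)).
  { apply tends_eq with (a := f 0); [now apply fcont | exact f0_of_flow]. }
  assert (L1 := tends_continuous_at_0 f 0 s Hc0).
  assert (L2 := tends_continuous_at_0 f 0 (- s) Hc0).
  assert (K : filterlim (fun h => (f (h * s) + f (- (h * s))) / h) (loc' 0) (loc 0)).
  { assert (K1 : filterlim (fun h => f h / h) (loc' 0) (loc c)).
    { generalize (proj1 (cderive_tends_0 _ _ _) fder).
      apply filterlim_ext. intros h. rewrite f0_of_flow, Cplus_0_l. f_equal. ring. }
    assert (K2 : forall r : C, r <> 0 -> filterlim (fun h => f (h * r) / h) (loc' 0) (loc (c * r))).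
    { intros r Hr. apply filterlim_ext_loc with (f := fun h => f (h * r) / (h * r) * r).
      - generalize (loc'_neq 0). apply filter_imp. intros h Hh. field. split; assumption.
      - tends. exact (filterlim_comp _ _ _ (fun h => h * r) (fun h => f h / h) _ _ _ (tends_mult_l' r Hr) K1). }
    assert (Hs' := Copp_neq_0 s Hs).
    apply filterlim_ext with (f := fun h : C => f (h * s) / h + f (h * - s) / h).
    - intros h. replace (h * - s) with (- (h * s)) by ring. unfold Cdiv; ring.
    - apply tends_eq with (a := c * s + c * - s); [tends; now apply K2 | ring]. }
  apply filterlim_ext_loc with (f := fun h => s * (x * x + y * y) * ((f (h * s) + f (- (h * s))) / h)
    / ((s + (y - x) * f (h * s)) * (s - (y - x) * f (h * - s)))).
  + generalize (filter_and _ _ (loc'_neq 0) Hdom). apply filter_imp. intros h [Hh Hd].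
    assert (E : h * x + h * y = h * s) by (unfold s; ring).
    assert (Hhs : h * x + h * y <> 0) by (rewrite E; now apply Cmult_neq_0).
    change (scale h (x, y)) with (h * x, h * y) in *.
    apply phi_tan_anti_dom_off_line in Hd; [|exact Hhs].
    destruct Hd as [[_ N1] [_ N2]].
    rewrite phi_tan_anti_off_line by assumption. rewrite E in *.
    replace (h * - s) with (- (h * s)) by ring.
    set (T := f (h * s)) in *. set (T' := f (- (h * s))) in *.
    assert (N1a : s + (y - x) * T <> 0).
    { intros F; apply N1. replace (h * s + (h * y - h * x) * T) with (h * (s + (y - x) * T)) by ring.
      rewrite F; ring. }
    assert (N2a : s - (y - x) * T' <> 0).
    { intros F; apply N2. replace (h * s - (h * y - h * x) * T') with (h * (s - (y - x) * T')) by ring.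
      rewrite F; ring. }
    simpl fst; simpl snd. unfold s in *. field. repeat split; assumption.
  + apply tends_eq with (a := s * (x * x + y * y) * 0 / ((s + (y - x) * 0) * (s - (y - x) * 0))).
    * tends; try assumption.
      replace (s + (y - x) * 0) with s by ring. replace (s - (y - x) * 0) with s by ring.
      now apply Cmult_neq_0.
    * field. replace (s + (y - x) * 0) with s by ring. replace (s - (y - x) * 0) with s by ring.
      exact Hs.
Qed.

Lemma odd_of_flow (t : C) : D t -> f (- t) = - f t.
Proof.
set (g := fun t => f t + f (- t)).
assert (Hg : forall t, D t -> cderive g t 0).
{ clear t. intros t Ht. destruct (Ceq_dec t 0) as [->|Ht0].
  (* [iterate_sum] needs t <> 0; at 0 the derivative is c - c by the chain rule. *)
  - assert (Hopp : cderive Copp 0 (- (1))) by (apply (cderive_opp (fun t => t)), cderive_id).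
    assert (fder' : cderive f (- 0) c) by (replace (- 0) with (RtoC 0) by ring; exact fder).
    refine (cderive_eq _ _ _ _ (cderive_plus _ _ _ _ _ fder (cderive_comp f Copp 0 _ _ fder' Hopp)) _). ring.
  - apply cderive_tends_0.
    set (w := ((1 + f t) / 2, (1 + f (- t)) / 2)).
    (* Since g t = 2 (fst w + snd w) - 2, the difference quotient of g at t is twice the quotient of
       [phi_tan_anti_sum_tends]. *)
    apply filterlim_ext_loc with (f := fun h => 2 *
      ((fst (phi_tan_anti f c (scale h w)) + snd (phi_tan_anti f c (scale h w))
        - h * (fst w + snd w)) / (h * h))).
    + assert (H1 : loc' 0 (fun h => t + h <> 0)).
      { apply loc_loc'. exact (tends_neq _ _ _ _ (tends_translate t) Ht0). }
      assert (H2 : loc' 0 (fun h => D (t + h))).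
      { apply loc_loc'. exact (tends_translate t _ (Dopen t Ht)). }
      generalize (filter_and _ _ (loc'_neq 0) (filter_and _ _ (proj1 (proj2 Hflow w)) (filter_and _ _ H1 H2))).
      apply filter_imp. intros h [Hh [Hw [Hth Dth]]].
      unfold g at 1. rewrite (iterate_sum t h Ht0 Hh Hth Ht Dth Hw). fold w.
      set (S := fst (phi_tan_anti f c (scale h w)) + snd (phi_tan_anti f c (scale h w))).
      unfold w, g; simpl fst; simpl snd. field. exact Hh.
    + apply tends_eq with (a := 2 * 0); [tends; apply phi_tan_anti_sum_tends | ring]. }
intros Ht.
assert (E := cderive_0_connected D g 0 (proj1 Hf) Dconn D0 Hg t Ht).
unfold g in E. replace (- 0) with (RtoC 0) in E by ring. rewrite f0_of_flow in E.
replace (f (- t)) with (f t + f (- t) - f t) by ring. rewrite E. ring.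
Qed.

Lemma addition_of_flow : tan_addition_formula D f.
Proof.
intros a b Ha Hb Hab N.
destruct (Ceq_dec a 0) as [->|Ha0]; [rewrite f0_of_flow, Cplus_0_l; field|].
destruct (Ceq_dec b 0) as [->|Hb0]; [rewrite f0_of_flow, Cplus_0_r; field|].
destruct (Ceq_dec (a + b) 0) as [E|Hab0].
{ rewrite E, f0_of_flow. replace b with (- a) in * by (replace b with (a + b - a) by ring; rewrite E; ring).
  rewrite odd_of_flow in * by exact Ha. field. exact N. }
(* On the diagonal with coordinate sum a + b and this z, the iterate starts from (b (1 + f a) / 2, b
   (1 - f a) / 2). Its coordinate sum is b and its denominators are b (1 - f a f b), so [N] is what
   puts it in the domain. *)
assert (Hz : a / (a + b) <> 0) by now apply Cdiv_neq_0.
assert (H := proj1 Hflow ((a + b) / 2, (a + b) / 2) _ Hz).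
assert (E1 : scale (a / (a + b)) ((a + b) / 2, (a + b) / 2) = (a / 2, a / 2)).
{ apply injective_projections; simpl; field; exact Hab0. }
rewrite E1, !phi_tan_anti_diag in H by assumption.
rewrite odd_of_flow in H by exact Ha.
assert (E2 : scale ((1 - a / (a + b)) / (a / (a + b))) (a / 2 * (1 + f a), a / 2 * (1 + - f a))
  = (b / 2 * (1 + f a), b / 2 * (1 - f a))).
{ apply injective_projections; simpl fst; simpl snd; field; split; assumption. }
rewrite E2 in H.
assert (Es : b / 2 * (1 + f a) + b / 2 * (1 - f a) = b) by field.
assert (Hs : b / 2 * (1 + f a) + b / 2 * (1 - f a) <> 0) by now rewrite Es.
assert (M1 : b + (b / 2 * (1 - f a) - b / 2 * (1 + f a)) * f b = b * (1 - f a * f b)) by field.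
assert (M2 : b - (b / 2 * (1 - f a) - b / 2 * (1 + f a)) * - f b = b * (1 - f a * f b)) by field.
assert (MN : b * (1 - f a * f b) <> 0) by now apply Cmult_neq_0.
assert (N1 : b / 2 * (1 + f a) + b / 2 * (1 - f a) +
  (b / 2 * (1 - f a) - b / 2 * (1 + f a)) * f (b / 2 * (1 + f a) + b / 2 * (1 - f a)) <> 0)
  by (rewrite Es, M1; exact MN).
assert (N2 : b / 2 * (1 + f a) + b / 2 * (1 - f a) -
  (b / 2 * (1 - f a) - b / 2 * (1 + f a)) * f (- (b / 2 * (1 + f a) + b / 2 * (1 - f a))) <> 0)
  by (rewrite Es, odd_of_flow, M2 by exact Hb; exact MN).
rewrite (phi_tan_anti_off_line f c _ _ Hs N1 N2) in H.
specialize (H (phi_tan_anti_dom_diag _ _ _ _ Hab0 Hab (Dopp _ Hab))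
  (phi_tan_anti_dom_diag _ _ _ _ Ha0 Ha (Dopp _ Ha))).
apply (f_equal fst) in H.
- unfold scale in H; simpl fst in H. rewrite Es, M1 in H.
  replace (f (a + b)) with ((1 - a / (a + b)) * ((a + b) / 2 * (1 + f (a + b))) * 2 / b - 1)
    by (field; split; assumption).
  rewrite H. field. split; assumption.
- apply phi_tan_anti_dom_off_line; [exact Hs|].
  repeat split; try assumption; rewrite Es; auto.
Qed.
End FlowOfTangentLike.

(** * The partial differential equation of the tangent flow *)

(** The function tan z / z with its removable singularity filled. It turns both branches of
    [u_tan Ctan 1] into one expression, which can be differentiated across x + y = 0. *)
Definition Ctanc (z : C) : C := if Ceq_dec z 0 then 1 else Ctan z / z.

Lemma Ctanc_0 : Ctanc 0 = 1.
Proof. unfold Ctanc. now destruct (Ceq_dec 0 0). Qed.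

Lemma Ctanc_neq_0 (z : C) : z <> 0 -> Ctanc z = Ctan z / z.
Proof. intros Hz. unfold Ctanc. now destruct (Ceq_dec z 0). Qed.

Lemma Ctan_Ctanc (z : C) : Ctan z = z * Ctanc z.
Proof.
destruct (Ceq_dec z 0) as [->|Hz]; [rewrite Ctan_0; ring|].
rewrite Ctanc_neq_0 by exact Hz. field. exact Hz.
Qed.

Lemma Ctan_dom_0 : Ctan_dom 0.
Proof. unfold Ctan_dom. rewrite Ccos_0. exact C1_nz. Qed.

Lemma cderive_Ctan_0 : cderive Ctan 0 1.
Proof.
refine (cderive_eq _ _ _ _ (cderive_Ctan 0 Ctan_dom_0) _). rewrite Ctan_0. ring.
Qed.

Lemma tends_Ctan_0 : filterlim Ctan (loc 0) (loc 0).
Proof.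
apply tends_eq with (a := Ctan 0); [|exact Ctan_0].
exact (cderive_continuous _ _ _ cderive_Ctan_0).
Qed.

(* The derivative [Ctan z ^ 2] of [Ctan z - z] is [O(|z|^2)], so by the mean
   value inequality [Ctan z - z] is [O(|z|^3)]. *)
Lemma cderive_Ctanc_0 : cderive Ctanc 0 0.
Proof.
(* Keeping the difference quotient within 1 of its limit 1 gives the constant 2. Its square 4 bounds
   the derivative, and the factor 2 of [mean_value] makes it the 8 of [Hcube]. *)
assert (Hlin : exists d : posreal, forall t : C, (Cmod t < d)%R ->
  Ctan_dom t /\ (Cmod (Ctan t) <= 2 * Cmod t)%R).
{ assert (H := proj1 (cderive_tends _ _ _) cderive_Ctan_0).
  apply tends_Cmod with (eps := mkposreal 1 Rlt_0_1) in H; [|typeclasses eauto]. simpl in H.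
  assert (H2 := filter_and _ _ (loc_loc' _ _ (Ctan_dom_loc 0 Ctan_dom_0)) H).
  apply locally_Cmod in H2. destruct H2 as [d Hd]. exists d. intros t Ht.
  destruct (Ceq_dec t 0) as [->|Ht0].
  - split; [exact Ctan_dom_0 | rewrite Ctan_0, Cmod_0; lra].
  - replace t with (t - 0) in Ht by ring. destruct (Hd t Ht Ht0) as [A B].
    split; [exact A|].
    rewrite Ctan_0 in B.
    replace (Ctan t) with (((Ctan t - 0) / (t - 0) - 1) * t + t)
      by (replace (t - 0) with t by ring; field; exact Ht0).
    eapply Rle_trans; [apply Cmod_triangle|]. rewrite Cmod_mult.
    pose proof (Cmod_ge_0 t). nra. }
destruct Hlin as [d Hd].
assert (Hcube : forall h : C, (Cmod h < d)%R ->
  (Cmod (Ctan h - h) <= 8 * (Cmod h * Cmod h * Cmod h))%R).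
{ intros h Hh.
  assert (M := mean_value (fun t => Ctan t - t) (fun t => Ctan t * Ctan t) 0 h
    (4 * (Cmod h * Cmod h))).
  replace (0 + h) with h in M by ring. rewrite Ctan_0 in M.
  replace (Ctan h - h - (0 - 0)) with (Ctan h - h) in M by ring.
  eapply Rle_trans; [apply M|lra].
  intros r Hr. replace (0 + r * h) with (r * h) by ring.
  assert (Hrh : (Cmod (r * h)%C <= Cmod h)%R).
  { rewrite Cmod_mult, Cmod_R. pose proof (Cmod_ge_0 h). nra. }
  destruct (Hd (r * h) (Rle_lt_trans _ _ _ Hrh Hh)) as [A B]. split.
  - refine (cderive_eq _ _ _ _ (cderive_minus _ _ _ _ _ (cderive_Ctan _ A) (cderive_id _)) _). ring.
  - rewrite Cmod_mult. pose proof (Cmod_ge_0 (Ctan (r * h))). pose proof (Cmod_ge_0 (r * h)). nra. }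
apply cderive_tends. apply tends_Cmod; [typeclasses eauto|]. intros eps.
assert (Hp : (0 < Rmin d (eps / 8))%R).
{ apply Rmin_pos; [apply cond_pos|]. pose proof (cond_pos eps). lra. }
apply locally_Cmod. exists (mkposreal _ Hp). simpl. intros h Hh Hh0.
replace (h - 0) with h in * by ring.
destruct (Rmin_Rgt_l _ _ _ Hh) as [H1 H2].
rewrite Ctanc_0, Ctanc_neq_0 by exact Hh0.
replace ((Ctan h / h - 1) / h - 0) with ((Ctan h - h) / (h * h)) by (field; exact Hh0).
rewrite Cmod_div by now apply Cmult_neq_0. rewrite Cmod_mult.
assert (Hm := proj1 (Cmod_gt_0 h) Hh0).
assert (Hm2 := Rmult_lt_0_compat _ _ Hm Hm).
apply Rmult_lt_reg_r with (Cmod h * Cmod h)%R; [exact Hm2|].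
unfold Rdiv at 1. rewrite Rmult_assoc, Rinv_l, Rmult_1_r by lra.
eapply Rle_lt_trans; [apply Hcube; exact H1|]. nra.
Qed.

(** The relation is tan' = 1 + tan^2 written for tan s = s k. It avoids the division by s in a
    formula for k', and so includes s = 0. *)
Lemma cderive_Ctanc (s : C) : Ctan_dom s -> exists k' : C, cderive Ctanc s k' /\
  s * k' + Ctanc s - 1 - s * s * (Ctanc s * Ctanc s) = 0.
Proof.
intros Hs. destruct (Ceq_dec s 0) as [->|Hs0].
- exists 0. split; [exact cderive_Ctanc_0 | rewrite Ctanc_0; ring].
- eexists. split.
  + apply cderive_ext_loc with (f := fun t => Ctan t / t).
    * assert (H := tends_neq _ (fun t : C => t) s 0 (filterlim_id _ _) Hs0).
      revert H. apply filter_imp. intros t Ht. now rewrite Ctanc_neq_0.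
    * exact (cderive_div _ _ _ _ _ (cderive_Ctan s Hs) (cderive_id s) Hs0).
  + simpl. rewrite Ctanc_neq_0 by exact Hs0. field. exact Hs0.
Qed.

Lemma u_tan_Ctanc (x y : C) : 1 + (y - x) * Ctanc (x + y) <> 0 ->
  u_tan Ctan 1 x y = (x + y * ((x + y) * Ctanc (x + y))) / (1 + (y - x) * Ctanc (x + y)).
Proof.
intros H. destruct (Ceq_dec (x + y) 0) as [Hs|Hs].
- rewrite u_tan_on_line by exact Hs. rewrite Hs, Ctanc_0 in *. f_equal; [|f_equal]; ring.
- rewrite u_tan_off_line by exact Hs. rewrite Ctan_Ctanc. field.
  split; [exact H|].
  replace (x + y + (y - x) * ((x + y) * Ctanc (x + y))) with
    ((x + y) * (1 + (y - x) * Ctanc (x + y))) by ring.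
  now apply Cmult_neq_0.
Qed.

Lemma u_tan_dom_Ctanc (x y : C) : u_tan_dom Ctan_dom Ctan 1 x y ->
  Ctan_dom (x + y) /\ 1 + (y - x) * Ctanc (x + y) <> 0.
Proof.
destruct (Ceq_dec (x + y) 0) as [Hs|Hs]; intros H.
- apply u_tan_dom_on_line in H; [|exact Hs]. destruct H as [H1 H2]. split; [exact H1|].
  rewrite Hs, Ctanc_0. neq H2.
- apply u_tan_dom_off_line in H; [|exact Hs]. destruct H as [H1 H2]. split; [exact H1|].
  intros E. apply H2. rewrite Ctan_Ctanc.
  replace (x + y + (y - x) * ((x + y) * Ctanc (x + y))) with
    ((x + y) * (1 + (y - x) * Ctanc (x + y))) by ring.
  rewrite E. ring.
Qed.

(** A curve (a t, b t) again serves both partial derivatives. The quotient rule is left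
    unsimplified, with [k'] as a variable subject only to the relation of [cderive_Ctanc]. *)
Lemma cderive_u_tan (a b : C -> C) (t a' b' k' : C) :
  cderive a t a' -> cderive b t b' -> cderive Ctanc (a t + b t) k' ->
  1 + (b t - a t) * Ctanc (a t + b t) <> 0 ->
  cderive (fun t => u_tan Ctan 1 (a t) (b t)) t
   (((a' + (b' * ((a t + b t) * Ctanc (a t + b t)) +
       b t * ((a' + b') * Ctanc (a t + b t) + (a t + b t) * ((a' + b') * k')))) *
      (1 + (b t - a t) * Ctanc (a t + b t)) -
     (a t + b t * ((a t + b t) * Ctanc (a t + b t))) *
      ((b' - a') * Ctanc (a t + b t) + (b t - a t) * ((a' + b') * k'))) /
    ((1 + (b t - a t) * Ctanc (a t + b t)) * (1 + (b t - a t) * Ctanc (a t + b t)))).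
Proof.
intros Ha Hb Hk HM.
assert (Hs := cderive_plus _ _ _ _ _ Ha Hb).
assert (Hks := cderive_comp Ctanc (fun t => a t + b t) _ _ _ Hk Hs).
assert (HN := cderive_plus _ _ _ _ _ Ha (cderive_mult _ _ _ _ _ Hb (cderive_mult _ _ _ _ _ Hs Hks))).
assert (HD := cderive_plus _ _ _ _ _ (cderive_const 1 t)
  (cderive_mult _ _ _ _ _ (cderive_minus _ _ _ _ _ Hb Ha) Hks)).
assert (HQ := cderive_div _ _ _ _ _ HN HD HM).
eapply cderive_eq.
- refine (cderive_ext_loc _ _ _ _ _ HQ).
  assert (Hne := tends_neq _ _ _ _ (cderive_continuous _ _ _ HD) HM).
  revert Hne. apply filter_imp. intros r Hr. now rewrite u_tan_Ctanc.
- cbv beta. field. exact HM.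
Qed.

Lemma tan_anti_pde : solves_pde (u_tan_dom Ctan_dom Ctan 1) (u_tan Ctan 1)
  varpi_tan (fun x y => - varrho_tan x y).
Proof.
intros x y Hxy. apply u_tan_dom_Ctanc in Hxy. destruct Hxy as [Hs HM].
destruct (cderive_Ctanc _ Hs) as [k' [Hk HR]].
eexists; eexists. split; [|split].
- exact (cderive_u_tan (fun t => t) (fun _ => y) x _ _ k' (cderive_id x) (cderive_const y x) Hk HM).
- exact (cderive_u_tan (fun _ => x) (fun t => t) y _ _ k' (cderive_const x y) (cderive_id y) Hk HM).
- rewrite u_tan_Ctanc by exact HM. unfold varrho_tan, varpi_tan. clear Hk Hs.
  set (k := Ctanc (x + y)) in *.
  (* As rational functions of x, y, k, k' the two sides are not equal: they differ by (x^2 + y^2) /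
     (1 + (y - x) k)^2 times the left side of [HR]. *)
  match goal with |- ?l = ?r => transitivity (r - (x * x + y * y) *
    ((x + y) * k' + k - 1 - (x + y) * (x + y) * (k * k)) /
    ((1 + (y - x) * k) * (1 + (y - x) * k))) end.
  + field. exact HM.
  + rewrite HR. field. exact HM.
Qed.

Lemma tan_sym_pde :
  solves_pde (u_tan_sym_dom Ctan_dom Ctan 1) (u_tan_sym Ctan 1) varpi_tan varrho_tan.
Proof.
intros x y Hxy. destruct (tan_anti_pde x (- y) Hxy) as [ux [uy [Hx [Hy HE]]]].
exists ux, (- uy). split; [exact Hx|split].
- refine (cderive_eq _ _ _ _ (cderive_comp (fun t => u_tan Ctan 1 x t) Copp y _ _ Hy
    (cderive_opp _ _ _ (cderive_id y))) _). ring.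
- change (u_tan_sym Ctan 1 x y) with (u_tan Ctan 1 x (- y)). rewrite <- HE.
  unfold varrho_tan, varpi_tan. ring.
Qed.

(** * The symmetric form of the tangent flow *)

Definition flip (p : C * C) : C * C := (fst p, - snd p).

Lemma Copp_opp (a : C) : - - a = a.
Proof. ring. Qed.

Lemma flip_flip (p : C * C) : flip (flip p) = p.
Proof. destruct p. unfold flip; simpl. now rewrite Copp_opp. Qed.

Lemma flip_scale (z : C) (p : C * C) : flip (scale z p) = scale z (flip p).
Proof. unfold flip, scale; simpl. f_equal. ring. Qed.

Section Conjugation.
Variables (dom dom' : C * C -> Prop) (phi phi' : C * C -> C * C).
Hypothesis Hdom : forall p, dom' p <-> dom (flip p).
Hypothesis Hphi : forall p, phi' p = flip (phi (flip p)).

(** [flip] is a linear involution, so it commutes with [scale] and can be moved through both sides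
    of the equation. *)
Lemma projective_translation_equation_flip :
  projective_translation_equation dom phi -> projective_translation_equation dom' phi'.
Proof.
intros H p z Hz. rewrite !Hdom, !Hphi, <- !flip_scale, !flip_flip.
rewrite flip_scale. intros H1 H2 H3. f_equal. now apply H.
Qed.

Lemma boundary_condition_flip : boundary_condition dom phi -> boundary_condition dom' phi'.
Proof.
intros H p. destruct (H (flip p)) as [H1 H2]. split.
- revert H1. apply filter_imp. intros z. now rewrite Hdom, flip_scale.
- apply tends_pair in H2; [|typeclasses eauto]. destruct H2 as [A B].
  apply filterlim_ext with (f := fun z : C => flip (scale (/ z) (phi (scale z (flip p))))).
  { intros z. now rewrite Hphi, flip_scale, flip_scale. }
  apply tends_pair; [typeclasses eauto|]. split; [exact A|].
  apply tends_eq with (a := - - snd p); [apply tends_opp; exact B | ring].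
Qed.

Lemma projective_flow_flip : projective_flow dom phi -> projective_flow dom' phi'.
Proof.
intros [H1 H2]. split;
  [now apply projective_translation_equation_flip | now apply boundary_condition_flip].
Qed.
End Conjugation.

Lemma phi_tan_sym_flip (f : C -> C) (c : C) (p : C * C) :
  phi_tan_sym f c p = flip (phi_tan_anti f c (flip p)).
Proof. destruct p. unfold phi_tan_anti, flip; simpl. now rewrite !Copp_opp. Qed.

Lemma phi_tan_sym_dom_flip (D : C -> Prop) (f : C -> C) (c : C) (p : C * C) :
  phi_tan_sym_dom D f c p <-> phi_tan_anti_dom D f c (flip p).
Proof. destruct p. unfold phi_tan_anti_dom, flip; simpl. now rewrite !Copp_opp. Qed.

Lemma phi_tan_anti_flip (f : C -> C) (c : C) (p : C * C) :
  phi_tan_anti f c p = flip (phi_tan_sym f c (flip p)).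
Proof. now rewrite phi_tan_sym_flip, !flip_flip. Qed.

Lemma phi_tan_anti_dom_flip (D : C -> Prop) (f : C -> C) (c : C) (p : C * C) :
  phi_tan_anti_dom D f c p <-> phi_tan_sym_dom D f c (flip p).
Proof. now rewrite phi_tan_sym_dom_flip, flip_flip. Qed.

Lemma Ctan_flow : projective_flow (phi_tan_anti_dom Ctan_dom Ctan 1) (phi_tan_anti Ctan 1).
Proof.
split.
- apply phi_tan_anti_translation; [exact Ctan_opp | exact Ctan_plus].
- apply phi_tan_anti_boundary; [exact (Ctan_dom_loc 0 Ctan_dom_0) | exact tends_Ctan_0].
Qed.

Lemma tan_anti_iff (D : C -> Prop) (f : C -> C) (c : C) :
  tangent_like D f c ->
  boundary_condition (phi_tan_anti_dom D f c) (phi_tan_anti f c) ->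
  (projective_flow (phi_tan_anti_dom D f c) (phi_tan_anti f c) <-> tan_addition_formula D f).
Proof.
intros Hf HB. split; [now apply addition_of_flow|].
intros Hadd. split; [|exact HB].
assert (f0 := f0_of_boundary D f c Hf HB).
apply phi_tan_anti_translation.
- intros t Ht. now apply (odd_of_addition D f c).
- intros a b. now apply (addition_without_division D f c).
Qed.

Theorem proposition1 :
  (projective_flow everywhere (phi_exp Cexp) /\
   symmetric_under swap everywhere (phi_exp Cexp) /\
   solves_pde (fun _ _ => True) (u_exp Cexp) varpi_exp varrho_exp) /\
  (projective_flow (phi_tan_sym_dom Ctan_dom Ctan 1) (phi_tan_sym Ctan 1) /\
   symmetric_under swap (phi_tan_sym_dom Ctan_dom Ctan 1) (phi_tan_sym Ctan 1) /\
   solves_pde (u_tan_sym_dom Ctan_dom Ctan 1) (u_tan_sym Ctan 1) varpi_tan varrho_tan) /\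
  (projective_flow (phi_tan_anti_dom Ctan_dom Ctan 1) (phi_tan_anti Ctan 1) /\
   symmetric_under antiswap (phi_tan_anti_dom Ctan_dom Ctan 1) (phi_tan_anti Ctan 1) /\
   solves_pde (u_tan_dom Ctan_dom Ctan 1) (u_tan Ctan 1)
     varpi_tan (fun x y => - varrho_tan x y)) /\
  (forall f : C -> C,
     boundary_condition everywhere (phi_exp f) ->
     (projective_flow everywhere (phi_exp f) <-> exp_addition_formula f)) /\
  (forall (D : C -> Prop) (f : C -> C) (c : C),
     tangent_like D f c ->
     boundary_condition (phi_tan_sym_dom D f c) (phi_tan_sym f c) ->
     (projective_flow (phi_tan_sym_dom D f c) (phi_tan_sym f c) <->
      tan_addition_formula D f)) /\
  (forall (D : C -> Prop) (f : C -> C) (c : C),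
     tangent_like D f c ->
     boundary_condition (phi_tan_anti_dom D f c) (phi_tan_anti f c) ->
     (projective_flow (phi_tan_anti_dom D f c) (phi_tan_anti f c) <->
      tan_addition_formula D f)).
Proof.
split; [|split; [|split; [|split; [|split]]]].
- split; [|split].
  + split.
    * apply exp_translation. exact Cexp_plus.
    * apply exp_boundary, tends_eq with (a := Cexp 0); [|exact Cexp_0].
      exact (cderive_continuous _ _ _ cderive_Cexp_0).
  + intros p _. split; [exact I | reflexivity].
  + exact exp_pde.
- split; [|split].
  + apply (projective_flow_flip _ _ _ _ (phi_tan_sym_dom_flip Ctan_dom Ctan 1)
      (phi_tan_sym_flip Ctan 1)). exact Ctan_flow.
  + intros p [H1 H2]. split; [exact (conj H2 H1) | reflexivity].
  + exact tan_sym_pde.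
- split; [exact Ctan_flow | split; [|exact tan_anti_pde]].
  intros [x y] [H1 H2]. unfold antiswap, phi_tan_anti_dom, phi_tan_anti; simpl in *.
  rewrite !Copp_opp. exact (conj (conj H2 H1) eq_refl).
- intros f HB. split; [apply exp_addition|].
  intros Hadd. split; [now apply exp_translation | exact HB].
- intros D f c Hf HB.
  assert (HB' := boundary_condition_flip _ _ _ _ (phi_tan_anti_dom_flip D f c)
    (phi_tan_anti_flip f c) HB).
  rewrite <- (tan_anti_iff D f c Hf HB').
  split; apply projective_flow_flip.
  + exact (phi_tan_anti_dom_flip D f c).
  + exact (phi_tan_anti_flip f c).
  + exact (phi_tan_sym_dom_flip D f c).
  + exact (phi_tan_sym_flip f c).
- exact tan_anti_iff.
Qed.
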